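(* Let $\Bbbk$ be a field. The graded minimal categorification $\mathcal{C}'_{\mathrm{edge}}$ satisfies, for every $n$, $$A_n^+v_{\mathrm{id}}=W_n^{\mathrm{edge}},\qquad A_n^-v_{w_0}=W_n^{\mathrm{edge}},$$ where $w_0\in S_n$ is the longest element, and the local elements $\partial_i,\partial_i^-$ $(1\le i\le n-1)$ generate all of $\operatorname{End}_{\Bbbk}(W_n^{\mathrm{edge}})$. Nevertheless, on three strands it has $\nu=1$ and $\lambda_i=\mu_i=0$ for $1\le i\le 3$, so it is not graded monoidally isomorphic to $\mathcal{NC}'$.
   Context: **Graded minimal categorifications.** Put $[k]=(q^k-q^{-k})/(q-q^{-1})$, $[n]!=[n]\cdots[1]$. A graded minimal categorification (of the quantum divided powers ring) is a $\Bbbk$-linear $\mathbb Z$-graded additive monoidal category with a generating object $X$ such that every object is a finite direct sum of grading shifts of $X^{\otimes n}$, there are no nonzero homs (of any degree) between $X^{\otimes n}$ and $X^{\otimes m}$ for $n\ne m$, and the full graded endomorphism algebra $A_n$ of $X^{\otimes n}$ is isomorphic to $\operatorname{End}_\Bbbk(W_n)$ for a graded vector space $W_n$ of graded dimension $[n]!$. Equivalently, it is a system of such graded algebras $A_n$ ($n\ge0$, $A_0=\Bbbk$) with unital graded algebra homomorphisms $\psi_{n,m}:A_n\otimes A_m\to A_{n+m}$ satisfying $\psi_{n+m,r}(\psi_{n,m}\otimes\mathrm{id})=\psi_{n,m+r}(\mathrm{id}\otimes\psi_{m,r})$ and $\psi_{0,n}=\psi_{n,0}=\mathrm{id}$. Graded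 monoidal isomorphisms are required to preserve the chosen generator, and induce graded algebra isomorphisms $\Phi_n:A_n\to A'_n$ commuting with all $\psi_{n,m}$. **The category $\mathcal{C}'_{\mathrm{edge}}$.** For $n\ge0$ let $W_n^{\mathrm{edge}}=\bigoplus_{w\in S_n}\Bbbk v_w$ with $\deg v_w=\binom n2-2\ell(w)$ ($\ell$ is Coxeter length, $s_i=(i,i+1)$), and $A_n=\operatorname{End}_\Bbbk(W_n^{\mathrm{edge}})$. Define $\partial_i,\partial_i^-\in A_n$ ($1\le i\le n-1$) by: $\partial_iv_w=v_{s_iw}$ if $\ell(s_iw)=\ell(w)+1$ and $0$ otherwise; $\partial_i^-v_w=v_{s_iw}$ if $\ell(s_iw)=\ell(w)-1$ and $0$ otherwise. Let $S^{n,m}$ be the set of minimal length representatives of the cosets $(S_n\times S_m)\backslash S_{n+m}$; each $w\in S_{n+m}$ factors uniquely as $w=(w_1\times w_2)u$ with $w_1\in S_n$, $w_2\in S_m$, $u\in S^{n,m}$, and lengths add. Let $M_{n,m}=\bigoplus_{u\in S^{n,m}}\Bbbk x_u$, $\deg x_u=nm-2\ell(u)$. Identify $W_{n+m}^{\mathrm{edge}}\cong W_n^{\mathrm{edge}}\otimes W_m^{\mathrm{edge}}\otimes M_{n,m}$ via $v_{(w_1\times w_2)u}\mapsto v_{w_1}\otimes v_{w_2}\otimes x_u$, and let $\psi_{n,m}:A_n\otimes A_m\to A_{n+m}$ be the map acting on the first two factors and trivially on $M_{n,m}$. This defines $\mathcal{C}'_{\mathrm{edge}}$. The elements $\partial_i,\partial_i^-\in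 A_n$ are the images of $\partial=\partial_1,\partial^-=\partial_1^-\in A_2$ placed in positions $i,i+1$. $A_n^+$ and $A_n^-$ are the subalgebras of $A_n$ generated by the $\partial_i$ and by the $\partial_i^-$, respectively. **The category $\mathcal{NC}'$.** This is the graded minimal categorification with $A_n=\widehat{\mathsf{NC}}_n$, the subalgebra of $\operatorname{End}_\Bbbk(\Bbbk[x_1,\dots,x_n])$ generated by the operators $\partial_i(f)=(f-s_if)/(x_i-x_{i+1})$ (degree $-2$) and $\partial_i^-=-x_i\partial_ix_{i+1}$ (degree $2$), $1\le i\le n-1$, with $\psi_{n,m}$ given by $\partial_i^{\pm}\otimes1\mapsto\partial_i^{\pm}$, $1\otimes\partial_j^{\pm}\mapsto\partial_{n+j}^{\pm}$. **Three-strand parameters.** For a graded minimal categorification, choose $\partial\in A_2^{-2}$, $\partial^-\in A_2^{2}$ with $\partial^2=(\partial^-)^2=0$, $\partial\partial^-+\partial^-\partial=1$ (unique up to $(t\partial,t^{-1}\partial^-)$, $t\in\Bbbk^\times$); let $\partial_i,\partial_i^-\in A_3$ ($i=1,2$) be their images in positions $i,i+1$. Normalize $W_3$ to have top degree $3$ and let $v$ span that degree; write $\partial_{ij\cdots}=\partial_i\partial_j\cdots$ and $v_-=\partial_{121}v$. If $W_3$ is generated by $v$ under $\partial_1,\partial_2$, then $v,\partial_1v,\partial_2v,\partial_{12}v,\partial_{21}v,v_-$ is a basis of $W_3$ and the scalars $\nu\in\Bbbk^\times$, $\lambda_i,\mu_i\in\Bbbk$ are defined by $\partial_2\partial_1\partial_2=\nu\,\partial_1\partial_2\partial_1$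 and $\partial_1^-v_-=\partial_{21}v+\lambda_1\partial_{12}v$, $\partial_1^-\partial_{12}v=\partial_2v+\lambda_2\partial_1v$, $\partial_1^-\partial_{21}v=\lambda_3\partial_1v-\lambda_1\partial_2v$, $\partial_1^-\partial_1v=v$, $\partial_1^-\partial_2v=-\lambda_2v$, $\partial_1^-v=0$; $\partial_2^-v_-=\nu^{-1}\partial_{12}v+\mu_1\partial_{21}v$, $\partial_2^-\partial_{12}v=\mu_3\partial_2v-\nu\mu_1\partial_1v$, $\partial_2^-\partial_{21}v=\partial_1v+\mu_2\partial_2v$, $\partial_2^-\partial_1v=-\mu_2v$, $\partial_2^-\partial_2v=v$, $\partial_2^-v=0$. *)

(* Defs.v *)
From HB Require Import structures.
From mathcomp Require Import all_boot all_order all_fingroup all_algebra.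
From mathcomp Require Import boolp.
From mathcomp Require Import ssrcomplements freeg mpoly.

Set Implicit Arguments.
Unset Strict Implicit.
Unset Printing Implicit Defensive.

Import GRing.Theory.
Local Open Scope ring_scope.

Definition qvar : {fraction {poly rat}} := tofrac ('X : {poly rat}).

Definition qint (k : nat) : {fraction {poly rat}} :=
  (qvar ^+ k - qvar ^- k) / (qvar - qvar^-1).

Definition qfact (n : nat) : {fraction {poly rat}} :=
  \prod_(1 <= k < n.+1) qint k.

Section Graded.
Variable K : fieldType.

(* W is the direct sum of its homogeneous components g d, and these vanish
   for d outside of the finite list s *)
Definition grading (W : vectType K) (g : int -> {vspace W}) (s : seq int) :=
  [/\ uniq s, forall d, d \notin s -> g d = 0%VS,
      (\sum_(d <- s) g d)%VS = fullv & directv (\sum_(d <- s) g d)].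

Definition graded_dim (W : vectType K) (g : int -> {vspace W}) (s : seq int) :
    {fraction {poly rat}} :=
  \sum_(d <- s) (\dim (g d))%:R * qvar ^ d.

Definition end_deg (W : vectType K) (g : int -> {vspace W}) (d : int)
    (a : 'End(W)) : Prop :=
  forall e, (a @: g e <= g (e + d)%R)%VS.

Definition gen_subalg (A : algType K) (S : A -> Prop) (a : A) : Prop :=
  forall B : {pred A}, subalg_closed B -> (forall x, S x -> x \in B) -> a \in B.

End Graded.

(* [gc_deg d a] means that [a] is homogeneous of degree [d], and [gc_psi] is
   the bilinear map underlying A_n (x) A_m -> A_(n+m). *)
Record gcat (K : fieldType) := GCat {
  gc_alg :> nat -> algType K;
  gc_deg : forall n, int -> gc_alg n -> Prop;
  gc_psi : forall n m, gc_alg n -> gc_alg m -> gc_alg (n + m)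
}.
Arguments gc_deg {K} _ {n} _ _.
Arguments gc_psi {K} _ {n m} _ _.

Section Gmc.
Variable K : fieldType.

Definition end_iso (C : gcat K) (n : nat) (W : vectType K)
    (g : int -> {vspace W}) (rho : C n -> 'End(W)) :=
  [/\ bijective rho, linear rho, rho 1 = \1%VF,
      forall a b, rho (a * b) = (rho a \o rho b)%VF &
      forall d a, gc_deg C d a <-> end_deg g d (rho a)].

Definition psi_morphism (C : gcat K) (n m : nat) :=
  [/\ forall (c : K) (a a' : C n) (b : C m),
        gc_psi C (c *: a + a') b = c *: gc_psi C a b + gc_psi C a' b,
      forall (c : K) (a : C n) (b b' : C m),
        gc_psi C a (c *: b + b') = c *: gc_psi C a b + gc_psi C a b',
      gc_psi C (1 : C n) (1 : C m) = 1,
      forall (a a' : C n) (b b' : C m),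
        gc_psi C (a * a') (b * b') = gc_psi C a b * gc_psi C a' b' &
      forall d e (a : C n) (b : C m), gc_deg C d a -> gc_deg C e b ->
        gc_deg C (d + e) (gc_psi C a b)].

(* The category is presented by the graded endomorphism algebras A_n of the
   powers of its generating object and the maps A_n (x) A_m -> A_(n+m). That the
   A_n are graded algebras is part of the isomorphism with End(W_n). *)
Definition graded_minimal_categorification (C : gcat K) :=
  [/\ forall n, exists (W : vectType K) (g : int -> {vspace W}) (s : seq int),
        [/\ grading g s, graded_dim g s = qfact n &
            exists rho : C n -> 'End(W), end_iso g rho],
      forall a : C 0, exists c : K, a = c%:A,
      forall n m, psi_morphism C n m,
      forall n m r (a : C n) (b : C m) (c : C r),
        gc_psi C (gc_psi C a b) c =
        ecast k (C k) (addnA n m r) (gc_psi C a (gc_psi C b c)) &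
      forall n (a : C n),
        gc_psi C (1 : C 0) a = a /\
        gc_psi C a (1 : C 0) = ecast k (C k) (esym (addn0 n)) a].

(* Graded monoidal isomorphism preserving the chosen generator. *)
Definition graded_monoidal_iso (C C' : gcat K) :=
  exists Phi : forall n, {lrmorphism C n -> C' n},
  [/\ forall n, bijective (Phi n),
      forall n d (a : C n), gc_deg C d a <-> gc_deg C' d (Phi n a) &
      forall n m (a : C n) (b : C m),
        Phi (n + m) (gc_psi C a b) = gc_psi C' (Phi n a) (Phi m b)].

Record three_strands (C : gcat K) := ThreeStrands {
  ts_d : C 2;
  ts_dm : C 2;
  ts_W : vectType K;
  ts_g : int -> {vspace ts_W};
  ts_s : seq int;
  ts_rho : C 3 -> 'End(ts_W);
  ts_v : ts_W;
  ts_d_deg : gc_deg C (-2) ts_d;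
  ts_dm_deg : gc_deg C 2 ts_dm;
  ts_d_sq : ts_d ^+ 2 = 0;
  ts_dm_sq : ts_dm ^+ 2 = 0;
  ts_ddm : ts_d * ts_dm + ts_dm * ts_d = 1;
  ts_grading : grading ts_g ts_s;
  ts_dim : graded_dim ts_g ts_s = qfact 3;
  ts_iso : end_iso ts_g ts_rho;
  (* as W_3 has graded dimension [3]!, its top degree is 3 *)
  ts_v_neq0 : ts_v != 0;
  ts_v_top : ts_g 3 = <[ts_v]>%VS
}.

Section Params.
Variables (C : gcat K) (T : three_strands C).

Definition ts_d1 : C 3 := @gc_psi K C 2 1 (ts_d T) 1.
Definition ts_d2 : C 3 := @gc_psi K C 1 2 1 (ts_d T).
Definition ts_dm1 : C 3 := @gc_psi K C 2 1 (ts_dm T) 1.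
Definition ts_dm2 : C 3 := @gc_psi K C 1 2 1 (ts_dm T).

Definition ts_generated :=
  forall w : ts_W T, exists2 a : C 3,
    gen_subalg (fun x => x = ts_d1 \/ x = ts_d2) a & ts_rho T a (ts_v T) = w.

Definition three_strand_parameters (nu l1 l2 l3 m1 m2 m3 : K) :=
  let act (a : C 3) (w : ts_W T) := ts_rho T a w in
  let v := ts_v T in
  let v1 := act ts_d1 v in
  let v2 := act ts_d2 v in
  let v12 := act (ts_d1 * ts_d2) v in
  let v21 := act (ts_d2 * ts_d1) v in
  let v_ := act (ts_d1 * ts_d2 * ts_d1) v in
  [/\ ts_generated,
      nu != 0,
      ts_d2 * ts_d1 * ts_d2 = nu *: (ts_d1 * ts_d2 * ts_d1),
      [/\ act ts_dm1 v_ = v21 + l1 *: v12,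
          act ts_dm1 v12 = v2 + l2 *: v1,
          act ts_dm1 v21 = l3 *: v1 - l1 *: v2 &
          [/\ act ts_dm1 v1 = v, act ts_dm1 v2 = - l2 *: v &
              act ts_dm1 v = 0]] &
      [/\ act ts_dm2 v_ = nu^-1 *: v12 + m1 *: v21,
          act ts_dm2 v12 = m3 *: v2 - (nu * m1) *: v1,
          act ts_dm2 v21 = v1 + m2 *: v2 &
          [/\ act ts_dm2 v1 = - m2 *: v, act ts_dm2 v2 = v &
              act ts_dm2 v = 0]]].

End Params.
End Gmc.

(* Everything is 0-indexed: [i : 'I_n.-1] stands for the pair of adjacent
   positions [pos_l i = i] and [pos_r i = i.+1] of 'I_n. *)
Definition pos_l n (i : 'I_n.-1) : 'I_n := widen_ord (leq_pred n) i.

Lemma pos_r_proof n (i : 'I_n.-1) : (i.+1 < n)%N.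
Proof. by rewrite -ltn_predRL. Qed.

Definition pos_r n (i : 'I_n.-1) : 'I_n := Ordinal (pos_r_proof i).

(* MathComp multiplies permutations from left to right. This is harmless:
   w |-> w^-1 exchanges the two conventions, and it fixes every s_i and
   preserves lengths and parabolic subgroups. *)
Definition srefl n (i : 'I_n.-1) : 'S_n := tperm (pos_l i) (pos_r i).

Definition is_word_of_size n (w : 'S_n) (k : nat) : bool :=
  [exists c : k.-tuple 'I_n.-1, w == (\prod_(i <- c) srefl i)%g].

Lemma srefl_gen n (w : 'S_n) : w \in <<[set srefl i | i : 'I_n.-1]>>%g.
Proof.
case: n w => [|n] w; first by have -> : w = 1%g by [apply/permP=> -[]]; exact: group1.
set G := <<_>>%g; suff /subsetP : [set: 'S_n.+1] \subset G by apply; rewrite inE.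
rewrite -(gen_tperm (ord0 : 'I_n.+1)) gen_subG; apply/subsetP=> _ /imsetP[y _ ->].
case: y => y; elim: y => [|y IH] lty.
  by rewrite [X in tperm _ X](_ : _ = ord0) ?tperm1 ?group1 //; apply: val_inj.
have inG (i : 'I_n) : srefl (n := n.+1) i \in G.
  by apply: mem_gen; apply/imsetP; exists i.
have := inG (Ordinal (lty : (y < n)%N)); set s := srefl _ => sG.
have lty' := ltnW lty.
have es : s = tperm (Ordinal lty') (Ordinal lty).
  by congr tperm; apply: val_inj.
case: y IH lty lty' s sG es => [|y] IH lty lty' s sG es.
  by rewrite (_ : ord0 = Ordinal lty') -?es //; apply: val_inj.
have -> : tperm ord0 (Ordinal lty) = (tperm ord0 (Ordinal lty') ^ s)%g.
  by rewrite tpermJ es tpermL tpermD //.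
by rewrite groupJ // IH.
Qed.

Lemma coxlen_proof n (w : 'S_n) : exists k, is_word_of_size w k.
Proof.
have /gen_prodgP[k [c Sc ->]] := srefl_gen w.
have /fin_all_exists[f fP] (i : 'I_k) : exists j : 'I_n.-1, c i = srefl j.
  by have /imsetP[j _ ->] := Sc i; exists j.
exists k; apply/existsP; exists [tuple f i | i < k]; apply/eqP.
by rewrite big_tuple; apply: eq_bigr => i _; rewrite tnth_mktuple.
Qed.

Definition coxlen n (w : 'S_n) : nat := ex_minn (coxlen_proof w).

Definition longest n : 'S_n := [arg max_(w > 1%g : 'S_n) coxlen w]%N.

Definition par_fun n m (w1 : 'S_n) (w2 : 'S_m) (i : 'I_(n + m)) : 'I_(n + m) :=
  match split i with
  | inl j => lshift m (w1 j)
  | inr j => rshift n (w2 j)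
  end.

Lemma par_fun_inj n m (w1 : 'S_n) (w2 : 'S_m) : injective (par_fun w1 w2).
Proof.
move=> i j; rewrite /par_fun.
case: (splitP i) => i' ei; case: (splitP j) => j' ej.
- by move/lshift_inj/perm_inj => e; apply: val_inj; rewrite /= ei ej e.
- by move/eqP; rewrite eq_lrshift.
- by move/eqP; rewrite eq_rlshift.
- by move/rshift_inj/perm_inj => e; apply: val_inj; rewrite /= ei ej e.
Qed.

(* w1 x w2 in S_n x S_m, as an element of S_(n+m) *)
Definition par n m (w1 : 'S_n) (w2 : 'S_m) : 'S_(n + m) :=
  perm (@par_fun_inj n m w1 w2).

(* the set S^(n,m) of representatives of (S_n x S_m) \ S_(n+m) *)
Definition min_coset_rep n m (u : 'S_(n + m)) : bool :=
  [forall w1 : 'S_n, forall w2 : 'S_m, coxlen u <= coxlen (par w1 w2 * u)%g]%N.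

Section Edge.
Variable K : fieldType.

Definition edgeW (n : nat) : vectType K := {ffun 'S_n -> K^o}.

Definition edgev n (w : 'S_n) : edgeW n := [ffun w' => (w' == w)%:R].

Definition edge_wt n (w : 'S_n) : int := 'C(n, 2)%:Z - 2 * (coxlen w)%:Z.

Definition edgeW_comp n (d : int) : {vspace edgeW n} :=
  <<[seq edgev w | w in [pred w : 'S_n | edge_wt w == d]]>>%VS.

Definition edge_alg (n : nat) : Type := 'End(edgeW n).

HB.instance Definition _ n := GRing.Lmodule.on (edge_alg n).

Lemma edge_alg_neq0 n : \1%VF != 0 :> 'End(edgeW n).
Proof.
apply/eqP=> /lfunP/(_ (edgev 1%g)); rewrite !lfunE /= => /ffunP/(_ 1%g).
by rewrite !ffunE eqxx; apply/eqP; rewrite oner_eq0.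
Qed.

(* the product of [edge_alg n] is composition of endomorphisms *)
HB.instance Definition _ n := GRing.Zmodule_isNzRing.Build (edge_alg n)
  (@comp_lfunA _ _ _ _ _) (@comp_lfun1l _ _ _) (@comp_lfun1r _ _ _)
  (@comp_lfunDl _ _ _ _) (@comp_lfunDr _ _ _ _) (@edge_alg_neq0 n).

HB.instance Definition _ n := GRing.Lmodule_isLalgebra.Build K (edge_alg n)
  (fun k (x y : 'End(edgeW n)) => comp_lfunZl k x y).

HB.instance Definition _ n := GRing.Lalgebra_isAlgebra.Build K (edge_alg n)
  (fun k (x y : 'End(edgeW n)) => comp_lfunZr k x y).

Definition edge_d n (i : 'I_n.-1) : edge_alg n :=
  linfun (fun f : edgeW n => \sum_(w : 'S_n)
    if coxlen (srefl i * w)%g == (coxlen w).+1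
    then f w *: edgev (srefl i * w)%g else 0).

Definition edge_dm n (i : 'I_n.-1) : edge_alg n :=
  linfun (fun f : edgeW n => \sum_(w : 'S_n)
    if (coxlen (srefl i * w)%g).+1 == coxlen w
    then f w *: edgev (srefl i * w)%g else 0).

Definition edge_app n (a : edge_alg n) : edgeW n -> edgeW n :=
  (a : 'End(edgeW n)).

Definition edge_plus n : edge_alg n -> Prop :=
  gen_subalg (fun y => exists i, y = edge_d i).

Definition edge_minus n : edge_alg n -> Prop :=
  gen_subalg (fun y => exists i, y = edge_dm i).

(* The image of x (x) y (x) x_u under the identification of
   W_n (x) W_m (x) M_(n,m) with W_(n+m). *)
Definition edge_glue n m (x : edgeW n) (y : edgeW m) (u : 'S_(n + m)) :
    edgeW (n + m) :=
  \sum_(w1 : 'S_n) \sum_(w2 : 'S_m) (x w1 * y w2) *: edgev (par w1 w2 * u)%g.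

Definition edge_psi n m (a : edge_alg n) (b : edge_alg m) : edge_alg (n + m) :=
  linfun (fun f : edgeW (n + m) =>
    \sum_(u : 'S_(n + m) | min_coset_rep u) \sum_(w1 : 'S_n) \sum_(w2 : 'S_m)
      f (par w1 w2 * u)%g *:
        edge_glue (edge_app a (edgev w1)) (edge_app b (edgev w2)) u).

Definition edge_cat : gcat K :=
  @GCat K edge_alg (fun n => end_deg (@edgeW_comp n)) edge_psi.

End Edge.

Lemma linear_ext (K : fieldType) (U V : lmodType K) (f g : {linear U -> V}) :
  f =1 g -> f = g.
Proof.
case: f g => [f [[f1] [f2]]] [g [[g1] [g2]]] /= /funext fg.
case: _ / fg in g1 g2 *.
by rewrite (Prop_irrelevance f1 g1) (Prop_irrelevance f2 g2).
Qed.

Section PolyEnd.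
Variables (K : fieldType) (n : nat).
Local Notation P := {mpoly K[n]}.

(* the algebra of K-linear endomorphisms of K[x_1, ..., x_n], with composition
   as product *)
Definition poly_end : Type := {linear P -> P}.

HB.instance Definition _ := gen_eqMixin poly_end.
HB.instance Definition _ := gen_choiceMixin poly_end.

Definition pe_fun (f : poly_end) : P -> P := (f : {linear P -> P}).

Implicit Types f g h : poly_end.

Lemma poly_endP f g : pe_fun f =1 pe_fun g -> f = g.
Proof. exact: linear_ext. Qed.

Definition pe0 : poly_end := \0 : {linear P -> P}.
Definition pe_add f g : poly_end := (pe_fun f \+ pe_fun g) : {linear P -> P}.
Definition pe_opp f : poly_end := (\- pe_fun f) : {linear P -> P}.
Definition pe_scale (c : K) f : poly_end := (c \*: pe_fun f) : {linear P -> P}.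
Definition pe1 : poly_end := idfun : {linear P -> P}.
Definition pe_mul f g : poly_end := (pe_fun f \o pe_fun g) : {linear P -> P}.

HB.instance Definition _ f := GRing.Linear.on (pe_fun f).

Lemma pe_addA : associative pe_add.
Proof. by move=> f g h; apply: poly_endP => p; apply: addrA. Qed.
Lemma pe_addC : commutative pe_add.
Proof. by move=> f g; apply: poly_endP => p; apply: addrC. Qed.
Lemma pe_add0 : left_id pe0 pe_add.
Proof. by move=> f; apply: poly_endP => p; apply: add0r. Qed.
Lemma pe_addN : left_inverse pe0 pe_opp pe_add.
Proof. by move=> f; apply: poly_endP => p; apply: addNr. Qed.
HB.instance Definition _ :=
  GRing.isZmodule.Build poly_end pe_addA pe_addC pe_add0 pe_addN.

Lemma pe_scaleA a b f : pe_scale a (pe_scale b f) = pe_scale (a * b) f.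
Proof. by apply: poly_endP => p; apply: scalerA. Qed.
Lemma pe_scale1 : left_id 1 pe_scale.
Proof. by move=> f; apply: poly_endP => p; apply: scale1r. Qed.
Lemma pe_scaleDr : right_distributive pe_scale +%R.
Proof. by move=> c f g; apply: poly_endP => p; apply: scalerDr. Qed.
Lemma pe_scaleDl f : {morph pe_scale^~ f : a b / a + b}.
Proof. by move=> a b; apply: poly_endP => p; apply: scalerDl. Qed.
HB.instance Definition _ := GRing.Zmodule_isLmodule.Build K poly_end
  pe_scaleA pe_scale1 pe_scaleDr pe_scaleDl.

Lemma pe_mulA : associative pe_mul.
Proof. by move=> f g h; apply: poly_endP. Qed.
Lemma pe_mul1l : left_id pe1 pe_mul.
Proof. by move=> f; apply: poly_endP. Qed.
Lemma pe_mul1r : right_id pe1 pe_mul.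
Proof. by move=> f; apply: poly_endP. Qed.
Lemma pe_mulDl : left_distributive pe_mul +%R.
Proof. by move=> f g h; apply: poly_endP. Qed.
Lemma pe_mulDr : right_distributive pe_mul +%R.
Proof. by move=> f g h; apply: poly_endP => p; apply: (linearD (pe_fun f)). Qed.
Lemma pe1_neq0 : pe1 != 0 :> poly_end.
Proof.
apply/eqP => /(congr1 (fun f => pe_fun f 1)) /eqP.
by rewrite /pe1 /= oner_eq0.
Qed.
HB.instance Definition _ := GRing.Zmodule_isNzRing.Build poly_end
  pe_mulA pe_mul1l pe_mul1r pe_mulDl pe_mulDr pe1_neq0.

Lemma pe_scaleAl c f g : c *: (f * g) = (c *: f) * g.
Proof. by apply: poly_endP. Qed.
HB.instance Definition _ := GRing.Lmodule_isLalgebra.Build K poly_end pe_scaleAl.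
Lemma pe_scaleAr c f g : c *: (f * g) = f * (c *: g).
Proof. by apply: poly_endP => p; exact: esym (linearZZ (pe_fun f : {linear P -> P}) c _). Qed.
HB.instance Definition _ := GRing.Lalgebra_isAlgebra.Build K poly_end pe_scaleAr.

End PolyEnd.

Section DividedDifference.
Variables (K : fieldType) (n : nat).
Local Notation P := {mpoly K[n]}.
Implicit Types (i : 'I_n.-1) (p q : P).

Lemma root_neq0 i : 'X_(pos_l i) - 'X_(pos_r i) != 0 :> P.
Proof.
rewrite subr_eq0; apply/eqP => /(congr1 (mcoeff U_(pos_l i)%MM))/eqP.
rewrite !mcoeffX eqxx eq_sym eq_mnm1.
by rewrite -val_eqE /= gtn_eqF // eq_sym oner_eq0.
Qed.

Lemma msym_sreflU i k : msym (srefl i) 'X_k = 'X_(srefl i k) :> P.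
Proof.
rewrite msymX; congr ('X_[_]); apply/mnmP => l.
by rewrite mnmE !mnm1E /srefl tpermV (canF_eq (tpermK _ _)).
Qed.

Lemma ddiff_ex i p :
  exists q, ('X_(pos_l i) - 'X_(pos_r i)) * q = p - msym (srefl i) p.
Proof.
pose Q (p : P) :=
  exists q, ('X_(pos_l i) - 'X_(pos_r i)) * q = p - msym (srefl i) p.
have QM p1 p2 : Q p1 -> Q p2 -> Q (p1 * p2).
  move=> [q1 e1] [q2 e2]; exists (q1 * p2 + msym (srefl i) p1 * q2).
  rewrite mulrDr mulrA e1 mulrCA e2 msymM mulrBl mulrBr.
  by rewrite addrA subrK.
have Q1 : Q 1 by exists 0; rewrite mulr0 msym1 subrr.
have QX j : Q 'X_j.
  rewrite /Q msym_sreflU /srefl; case: tpermP => [->|->|_ _].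
  - by exists 1; rewrite mulr1.
  - by exists (-1); rewrite mulrN1 opprB.
  - by exists 0; rewrite mulr0 subrr.
elim/mpolyind: p => [|c m p _ _ [q eq]].
  by exists 0; rewrite mulr0 raddf0 subrr.
have [q' eq'] : Q 'X_[m].
  rewrite mpolyXE_id; elim/big_ind: _ => // j _.
  by elim: (m j) => // k IH; rewrite exprS; apply: QM.
exists (c *: q' + q); rewrite mulrDr eq -scalerAr eq' scalerBr.
by rewrite msymD msymZ opprD addrACA.
Qed.

(* (p - s_i p) / (x_i - x_(i+1)) *)
Definition ddiff_fun i p : P := sval (cid (ddiff_ex i p)).

Lemma ddiff_funE i p :
  ('X_(pos_l i) - 'X_(pos_r i)) * ddiff_fun i p = p - msym (srefl i) p.
Proof. by rewrite /ddiff_fun; case: cid. Qed.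

Lemma ddiff_uniq i p q :
  ('X_(pos_l i) - 'X_(pos_r i)) * q = p - msym (srefl i) p ->
  q = ddiff_fun i p.
Proof. by rewrite -ddiff_funE => /(mulfI (root_neq0 i)). Qed.

Lemma ddiff_is_linear i : linear (ddiff_fun i).
Proof.
move=> c p q; apply/esym/ddiff_uniq.
rewrite mulrDr -scalerAr !ddiff_funE msymD msymZ scalerBr.
by rewrite opprD addrACA.
Qed.

HB.instance Definition _ i :=
  GRing.isLinear.Build K P P *:%R (ddiff_fun i) (ddiff_is_linear i).

Definition ddiff i : poly_end K n := ddiff_fun i : {linear P -> P}.

Definition mulX_fun (k : 'I_n) (p : P) : P := 'X_k * p.

Lemma mulX_is_linear k : linear (mulX_fun k).
Proof. by move=> c p q; rewrite /mulX_fun mulrDr scalerAr. Qed.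

HB.instance Definition _ k :=
  GRing.isLinear.Build K P P *:%R (mulX_fun k) (mulX_is_linear k).

Definition mulX (k : 'I_n) : poly_end K n := mulX_fun k : {linear P -> P}.

Definition ddiffm i : poly_end K n := - (mulX (pos_l i) * ddiff i * mulX (pos_r i)).

Definition nc_gen (a : poly_end K n) : Prop :=
  (exists i, a = ddiff i) \/ (exists i, a = ddiffm i).

Definition nc_mem : {pred poly_end K n} := [pred a | `[< gen_subalg nc_gen a >]].

Lemma nc_memP a : reflect (gen_subalg nc_gen a) (a \in nc_mem).
Proof. exact: asboolP. Qed.

Lemma nc_subalg_closed : subalg_closed nc_mem.
Proof.
split=> [|c a b /nc_memP ga /nc_memP gb|a b /nc_memP ga /nc_memP gb];
  apply/nc_memP => B cB sB; have [B1 BL BM] := cB.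
- exact: B1.
- by apply: BL; [apply: ga|apply: gb].
- by apply: BM; [apply: ga|apply: gb].
Qed.

Record nc_alg : Type := NCAlg { nc_val : poly_end K n; nc_valP : nc_val \in nc_mem }.

HB.instance Definition _ := [isSub for nc_val].
HB.instance Definition _ := [Choice of nc_alg by <:].
HB.instance Definition _ := GRing.SubChoice_isSubAlgebra.Build
  K (poly_end K n) nc_mem nc_alg (GRing.subalg_closed_semi nc_subalg_closed).

(* x_i has degree 2 *)
Definition nc_deg (d : int) (a : nc_alg) : Prop :=
  forall (k : nat) (p : P), p \is k.-homog ->
    pe_fun (nc_val a) p = 0 \/
    exists2 l : nat, 2 * l%:Z = 2 * k%:Z + d & pe_fun (nc_val a) p \is l.-homog.

End DividedDifference.

Section NCTensor.
Variables (K : fieldType) (n m : nat).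
Local Notation P := {mpoly K[n + m]}.

(* K[x_1, ..., x_(n+m)] = K[x_1, ..., x_n] (x) K[x_(n+1), ..., x_(n+m)] *)
Definition pol_l : {mpoly K[n]} -> P :=
  comp_mpoly [tuple 'X_(lshift m i) | i < n].
Definition pol_r : {mpoly K[m]} -> P :=
  comp_mpoly [tuple 'X_(rshift n i) | i < m].
Definition mon_l (u : 'X_{1..n + m}) : 'X_{1..n} :=
  [multinom u (lshift m i) | i < n].
Definition mon_r (u : 'X_{1..n + m}) : 'X_{1..m} :=
  [multinom u (rshift n i) | i < m].

HB.instance Definition _ := GRing.RMorphism.on pol_l.
HB.instance Definition _ := GRing.Linear.on pol_l.
HB.instance Definition _ := GRing.RMorphism.on pol_r.
HB.instance Definition _ := GRing.Linear.on pol_r.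

(* the operator a (x) b, cf. [tensE] *)
Definition tens_fun (a : poly_end K n) (b : poly_end K m) (p : P) : P :=
  \sum_(u <- msupp p)
    p@_u *: (pol_l (pe_fun a 'X_[mon_l u]) * pol_r (pe_fun b 'X_[mon_r u])).

Lemma tens_funE (a : poly_end K n) (b : poly_end K m) (k : nat) (p : P) :
  (msize p <= k)%N -> tens_fun a b p = \sum_(u : bmultinom (n + m) k)
    p@_u *: (pol_l (pe_fun a 'X_[mon_l u]) * pol_r (pe_fun b 'X_[mon_r u])).
Proof.
move=> le_pk; set I : subFinType _ := bmultinom (n + m) k.
rewrite /tens_fun (big_mksub I) ?msupp_uniq //=; last first.
  by move=> x /msize_mdeg_lt /leq_trans; apply.
by rewrite big_rmcond //= => j /memN_msupp_eq0 ->; rewrite scale0r.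
Qed.

Lemma tens_is_linear a b : linear (tens_fun a b).
Proof.
move=> c p q; pose k := maxn (msize (c *: p + q)) (maxn (msize p) (msize q)).
rewrite !(@tens_funE a b k) ?leq_max ?leqnn ?orbT // scaler_sumr -big_split /=.
by apply: eq_bigr => u _; rewrite mcoeffD mcoeffZ scalerDl scalerA.
Qed.

HB.instance Definition _ a b :=
  GRing.isLinear.Build K P P *:%R (tens_fun a b) (tens_is_linear a b).

Definition tens a b : poly_end K (n + m) := tens_fun a b : {linear P -> P}.

Lemma tensX a b u : pe_fun (tens a b) 'X_[u] =
  pol_l (pe_fun a 'X_[mon_l u]) * pol_r (pe_fun b 'X_[mon_r u]).
Proof. by rewrite /= /tens_fun msuppX big_seq1 mcoeffX eqxx scale1r. Qed.

Lemma polX (u : 'X_{1..n + m}) : 'X_[u] = pol_l 'X_[mon_l u] * pol_r 'X_[mon_r u].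
Proof.
rewrite /pol_l /pol_r !comp_mpolyX mpolyXE_id big_split_ord /=.
by congr (_ * _); apply: eq_bigr => i _; rewrite tnth_mktuple mnmE.
Qed.

Lemma polXX (u : 'X_{1..n}) (v : 'X_{1..m}) : exists w : 'X_{1..n + m},
  mon_l w = u /\ mon_r w = v.
Proof.
exists [multinom match split i with inl j => u j | inr j => v j end | i < n + m].
split; apply/mnmP => i; rewrite !mnmE.
  by rewrite (unsplitK (inl i)).
by rewrite (unsplitK (inr i)).
Qed.

Lemma poly_endXP (k : nat) (f g : poly_end K k) :
  (forall u, pe_fun f 'X_[u] = pe_fun g 'X_[u]) -> f = g.
Proof.
move=> fg; apply: poly_endP => p; rewrite [p]mpolyE !linear_sum.
by apply: eq_bigr => u _; rewrite !linearZ /= fg.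
Qed.

Lemma tensE a b p q :
  pe_fun (tens a b) (pol_l p * pol_r q) = pol_l (pe_fun a p) * pol_r (pe_fun b q).
Proof.
rewrite {1}[p]mpolyE [in RHS](mpolyE p) !linear_sum /= !mulr_suml linear_sum.
apply: eq_bigr => u _; rewrite !linearZ /= -!scalerAl !linearZ /=; congr (_ *: _).
rewrite {1}[q]mpolyE [in RHS](mpolyE q) !linear_sum /= !mulr_sumr linear_sum.
apply: eq_bigr => v _; rewrite !linearZ /= -!scalerAr !linearZ /=; congr (_ *: _).
by have [w [<- <-]] := polXX u v; rewrite -polX; apply: tensX.
Qed.

Lemma tensM a a' b b' : tens (a * a') (b * b') = tens a b * tens a' b'.
Proof.
apply: poly_endXP => u; rewrite polX tensE.
by rewrite -[RHS]/(pe_fun (tens a b) (pe_fun (tens a' b') _)) !tensE.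
Qed.

Lemma tens1 : tens 1 1 = 1.
Proof. by apply: poly_endXP => u; rewrite polX tensE. Qed.

Lemma tensDl c a a' b : tens (c *: a + a') b = c *: tens a b + tens a' b.
Proof.
apply: poly_endP => p; rewrite /= /pe_scale /= /tens_fun /GRing.scale_fun.
rewrite scaler_sumr -big_split; apply: eq_bigr => u _ /=.
rewrite [pol_l _](linearP pol_l c) mulrDl scalerDr -scalerAl.
by rewrite !scalerA mulrC.
Qed.

Lemma tensDr c a b b' : tens a (c *: b + b') = c *: tens a b + tens a b'.
Proof.
apply: poly_endP => p; rewrite /= /pe_scale /= /tens_fun /GRing.scale_fun.
rewrite scaler_sumr -big_split; apply: eq_bigr => u _ /=.
rewrite [pol_r _](linearP pol_r c) mulrDr scalerDr -scalerAr.
by rewrite !scalerA mulrC.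
Qed.

End NCTensor.

Lemma lrmorph_mpoly_ext (K : fieldType) (n : nat) (A : comAlgType K)
    (f g : {lrmorphism {mpoly K[n]} -> A}) :
  (forall k, f 'X_k = g 'X_k) -> f =1 g.
Proof.
move=> fg p; rewrite [p]mpolyE !linear_sum; apply: eq_bigr => u _.
rewrite !linearZ /= mpolyXE_id !rmorph_prod; congr (_ *: _).
by apply: eq_bigr => k _; rewrite !rmorphXn /= fg.
Qed.

Section NCPsi.
Variables (K : fieldType) (n m : nat).

Lemma shl_proof (i : 'I_n.-1) : (i < (n + m).-1)%N.
Proof. by rewrite ltn_predRL (leq_trans (pos_r_proof i)) ?leq_addr. Qed.
Definition shl (i : 'I_n.-1) : 'I_(n + m).-1 := Ordinal (shl_proof i).

Lemma shr_proof (i : 'I_m.-1) : (n + i < (n + m).-1)%N.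
Proof. by rewrite ltn_predRL -addnS ltn_add2l pos_r_proof. Qed.
Definition shr (i : 'I_m.-1) : 'I_(n + m).-1 := Ordinal (shr_proof i).

Lemma pos_l_shl i : pos_l (shl i) = lshift m (pos_l i).
Proof. exact: val_inj. Qed.
Lemma pos_r_shl i : pos_r (shl i) = lshift m (pos_r i).
Proof. exact: val_inj. Qed.
Lemma pos_l_shr i : pos_l (shr i) = rshift n (pos_l i).
Proof. exact: val_inj. Qed.
Lemma pos_r_shr i : pos_r (shr i) = rshift n (pos_r i).
Proof. by apply: val_inj; rewrite /= addnS. Qed.

Lemma pol_lU k : @pol_l K n m 'X_k = 'X_(@lshift n m k).
Proof. by rewrite /pol_l comp_mpolyXU -tnth_nth tnth_mktuple. Qed.
Lemma pol_rU k : @pol_r K n m 'X_k = 'X_(@rshift n m k).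
Proof. by rewrite /pol_r comp_mpolyXU -tnth_nth tnth_mktuple. Qed.

Lemma srefl_shl_l i k : srefl (shl i) (lshift m k) = lshift m (srefl i k).
Proof.
rewrite /srefl pos_l_shl pos_r_shl; case: (tpermP _ _ k) => [->|->|/eqP l /eqP r].
- by rewrite tpermL.
- by rewrite tpermR.
- by rewrite tpermD // eq_lshift eq_sym.
Qed.
Lemma srefl_shl_r i k : srefl (shl i) (rshift n k) = rshift n k.
Proof. by rewrite /srefl pos_l_shl pos_r_shl tpermD // eq_lrshift. Qed.
Lemma srefl_shr_r i k : srefl (shr i) (rshift n k) = rshift n (srefl i k).
Proof.
rewrite /srefl pos_l_shr pos_r_shr; case: (tpermP _ _ k) => [->|->|/eqP l /eqP r].
- by rewrite tpermL.
- by rewrite tpermR.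
- by rewrite tpermD // eq_rshift eq_sym.
Qed.
Lemma srefl_shr_l i k : srefl (shr i) (lshift m k) = lshift m k.
Proof. by rewrite /srefl pos_l_shr pos_r_shr tpermD // eq_rlshift. Qed.

Lemma msym_shl_l i p : msym (srefl (shl i)) (@pol_l K n m p) = pol_l m (msym (srefl i) p).
Proof.
apply: (lrmorph_mpoly_ext (f := msym _ \o @pol_l K n m) (g := @pol_l K n m \o msym _)) => k /=.
by rewrite msym_sreflU !pol_lU msym_sreflU srefl_shl_l.
Qed.
Lemma msym_shl_r i p : msym (srefl (shl i)) (@pol_r K n m p) = pol_r n p.
Proof.
apply: (lrmorph_mpoly_ext (f := msym _ \o @pol_r K n m) (g := @pol_r K n m)) => k /=.
by rewrite !pol_rU msym_sreflU srefl_shl_r.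
Qed.
Lemma msym_shr_r i p : msym (srefl (shr i)) (@pol_r K n m p) = pol_r n (msym (srefl i) p).
Proof.
apply: (lrmorph_mpoly_ext (f := msym _ \o @pol_r K n m) (g := @pol_r K n m \o msym _)) => k /=.
by rewrite msym_sreflU !pol_rU msym_sreflU srefl_shr_r.
Qed.
Lemma msym_shr_l i p : msym (srefl (shr i)) (@pol_l K n m p) = pol_l m p.
Proof.
apply: (lrmorph_mpoly_ext (f := msym _ \o @pol_l K n m) (g := @pol_l K n m)) => k /=.
by rewrite !pol_lU msym_sreflU srefl_shr_l.
Qed.

Lemma tens_mulX_l k : tens (mulX K k) (1 : poly_end K m) = mulX K (@lshift n m k).
Proof.
apply: poly_endXP => u; rewrite polX tensE.
by rewrite -[pe_fun _ _]/('X_k * _) rmorphM /= pol_lU -mulrA.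
Qed.
Lemma tens_mulX_r k : tens (1 : poly_end K n) (mulX K k) = mulX K (@rshift n m k).
Proof.
apply: poly_endXP => u; rewrite polX tensE.
by rewrite -[pe_fun (mulX K k) _]/('X_k * _) rmorphM /= pol_rU mulrCA.
Qed.

Lemma tens_ddiff_l i : tens (ddiff K i) (1 : poly_end K m) = ddiff K (shl i).
Proof.
apply: poly_endXP => u; rewrite polX tensE; apply: ddiff_uniq.
rewrite pos_l_shl pos_r_shl -!pol_lU -rmorphB mulrA -rmorphM /= ddiff_funE.
by rewrite msymM msym_shl_l msym_shl_r rmorphB mulrBl.
Qed.
Lemma tens_ddiff_r i : tens (1 : poly_end K n) (ddiff K i) = ddiff K (shr i).
Proof.
apply: poly_endXP => u; rewrite polX tensE; apply: ddiff_uniq.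
rewrite pos_l_shr pos_r_shr -!pol_rU -rmorphB mulrCA -rmorphM /= ddiff_funE.
by rewrite msymM msym_shr_l msym_shr_r rmorphB mulrBr.
Qed.

Lemma tens0l b : tens (0 : poly_end K n) b = 0 :> poly_end K (n + m).
Proof.
by apply: poly_endP => p; apply: big1 => u _; rewrite [pol_l _ _]raddf0 mul0r scaler0.
Qed.
Lemma tens0r a : tens a (0 : poly_end K m) = 0 :> poly_end K (n + m).
Proof.
by apply: poly_endP => p; apply: big1 => u _; rewrite [pol_r _ _]raddf0 mulr0 scaler0.
Qed.

Lemma tens_ddiffm_l i : tens (ddiffm K i) (1 : poly_end K m) = ddiffm K (shl i).
Proof.
rewrite /ddiffm -[X in tens X]addr0 -scaleN1r tensDl tens0l addr0 scaleN1r.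
rewrite -{1}[1 : poly_end K m]mulr1 tensM -{1}[1 : poly_end K m]mulr1 tensM.
by rewrite tens_ddiff_l !tens_mulX_l pos_l_shl pos_r_shl.
Qed.
Lemma tens_ddiffm_r i : tens (1 : poly_end K n) (ddiffm K i) = ddiffm K (shr i).
Proof.
rewrite /ddiffm -[X in tens _ X]addr0 -scaleN1r tensDr tens0r addr0 scaleN1r.
rewrite -{1}[1 : poly_end K n]mulr1 tensM -{1}[1 : poly_end K n]mulr1 tensM.
by rewrite tens_ddiff_r !tens_mulX_r pos_l_shr pos_r_shr.
Qed.

Lemma nc_mem_gen k (a : poly_end K k) : nc_gen a -> a \in @nc_mem K k.
Proof. by move=> ga; apply/nc_memP => B _; apply. Qed.

Lemma nc_mem_tens a b :
  a \in @nc_mem K n -> b \in @nc_mem K m -> tens a b \in @nc_mem K (n + m).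
Proof.
have [N1 NL NM] := @nc_subalg_closed K (n + m).
move=> /nc_memP ga /nc_memP gb; rewrite -[a]mulr1 -[b]mul1r tensM; apply: (NM).
  apply: (ga [pred x | tens x 1 \in @nc_mem K (n + m)]).
    split=> [|c x y|x y]; rewrite !inE ?tens1 // => xN yN.
      by rewrite tensDl; apply: (NL).
    by rewrite -[1 : poly_end K m]mulr1 tensM; apply: (NM).
  move=> x [] [i ->]; rewrite inE ?tens_ddiff_l ?tens_ddiffm_l; apply: nc_mem_gen.
    by left; exists (shl i).
  by right; exists (shl i).
apply: (gb [pred x | tens 1 x \in @nc_mem K (n + m)]).
  split=> [|c x y|x y]; rewrite !inE ?tens1 // => xN yN.
    by rewrite tensDr; apply: NL.
  by rewrite -[1 : poly_end K n]mulr1 tensM; apply: (NM).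
move=> x [] [i ->]; rewrite inE ?tens_ddiff_r ?tens_ddiffm_r; apply: nc_mem_gen.
  by left; exists (shr i).
by right; exists (shr i).
Qed.

Definition nc_psi (a : nc_alg K n) (b : nc_alg K m) : nc_alg K (n + m) :=
  NCAlg (nc_mem_tens (nc_valP a) (nc_valP b)).

End NCPsi.

Definition nc_d (K : fieldType) n (i : 'I_n.-1) : nc_alg K n :=
  NCAlg (nc_mem_gen (or_introl (ex_intro _ i erefl) : nc_gen (ddiff K i))).
Definition nc_dm (K : fieldType) n (i : 'I_n.-1) : nc_alg K n :=
  NCAlg (nc_mem_gen (or_intror (ex_intro _ i erefl) : nc_gen (ddiffm K i))).

(* [nc_psi] is the algebra map prescribed on the generators *)
Lemma nc_psiE (K : fieldType) n m (i : 'I_n.-1) (j : 'I_m.-1) :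
  [/\ nc_psi (nc_d K i) (1 : nc_alg K m) = nc_d K (shl m i),
      nc_psi (nc_dm K i) (1 : nc_alg K m) = nc_dm K (shl m i),
      nc_psi (1 : nc_alg K n) (nc_d K j) = nc_d K (shr n j) &
      nc_psi (1 : nc_alg K n) (nc_dm K j) = nc_dm K (shr n j)].
Proof.
split; apply: val_inj => /=.
- exact: tens_ddiff_l.
- exact: tens_ddiffm_l.
- exact: tens_ddiff_r.
- exact: tens_ddiffm_r.
Qed.

Definition nc_cat (K : fieldType) : gcat K :=
  @GCat K (nc_alg K) (@nc_deg K) (@nc_psi K).

Section NCMorphism.
Variables (K : fieldType) (n m : nat).

Lemma mdeg_split (u : 'X_{1..n + m}) : mdeg u = (mdeg (mon_l u) + mdeg (mon_r u))%N.
Proof.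
rewrite !mdegE big_split_ord /=.
by congr (_ + _)%N; apply: eq_bigr => i _; rewrite mnmE.
Qed.

Lemma pol_l_homog d (p : {mpoly K[n]}) : p \is d.-homog -> pol_l m p \is d.-homog.
Proof.
move=> /dhomogP hp; rewrite [p]mpolyE linear_sum big_seq; apply: rpred_sum => u up.
rewrite linearZ; apply: rpredZ.
have [w [wl wr]] := @polXX n m u 0%MM.
have e : 'X_[w] = pol_l m 'X_[u] :> {mpoly K[n + m]}.
  by rewrite polX wl wr mpolyX0 rmorph1 mulr1.
have : ('X_[w] : {mpoly K[n + m]}) \is d.-homog.
  by rewrite dhomogX /= mdeg_split wl wr mdeg0 addn0 hp.
by rewrite e.
Qed.

Lemma pol_r_homog d (p : {mpoly K[m]}) : p \is d.-homog -> pol_r n p \is d.-homog.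
Proof.
move=> /dhomogP hp; rewrite [p]mpolyE linear_sum big_seq; apply: rpred_sum => u up.
rewrite linearZ; apply: rpredZ.
have [w [wl wr]] := @polXX n m 0%MM u.
have e : 'X_[w] = pol_r n 'X_[u] :> {mpoly K[n + m]}.
  by rewrite polX wl wr mpolyX0 rmorph1 mul1r.
have : ('X_[w] : {mpoly K[n + m]}) \is d.-homog.
  by rewrite dhomogX /= mdeg_split wl wr mdeg0 add0n hp.
by rewrite e.
Qed.

Lemma nc_psi_deg d e (a : nc_alg K n) (b : nc_alg K m) :
  nc_deg d a -> nc_deg e b -> nc_deg (d + e) (nc_psi a b).
Proof.
move=> da eb k p hp.
pose t u := pol_l m (pe_fun (nc_val a) 'X_[mon_l u]) *
            pol_r n (pe_fun (nc_val b) 'X_[mon_r u]).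
have ht u : u \in msupp p -> t u = 0 \/
    exists2 l : nat, 2 * l%:Z = 2 * k%:Z + (d + e) & t u \is l.-homog.
  move=> up.
  have /da[t0|[l1 e1 h1]] : ('X_[mon_l u] : {mpoly K[n]}) \is (mdeg (mon_l u)).-homog.
    by rewrite dhomogX.
    by left; rewrite /t t0 rmorph0 mul0r.
  have /eb[t0|[l2 e2 h2]] : ('X_[mon_r u] : {mpoly K[m]}) \is (mdeg (mon_r u)).-homog.
    by rewrite dhomogX.
    by left; rewrite /t t0 rmorph0 mulr0.
  right; exists (l1 + l2)%N.
    have <- : mdeg u = k by move: (hp) => /dhomogP; apply.
    by rewrite mdeg_split !PoszD !mulrDr e1 e2 addrACA.
  by apply: dhomogM; [apply: pol_l_homog|apply: pol_r_homog].
have -> : pe_fun (nc_val (nc_psi a b)) p = \sum_(u <- msupp p) p@_u *: t u by [].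
have [[l el]|nl] := pselect (exists l : nat, 2 * l%:Z = 2 * k%:Z + (d + e)).
  right; exists l => //; rewrite big_seq; apply: rpred_sum => u up; apply: rpredZ.
  have [->|[l' el' //]] := ht u up; first exact: rpred0.
  suff -> : l' = l by [].
  by move: el'; rewrite -el => /(mulfI (isT : (2 : int) != 0)) [].
left; rewrite big_seq big1 // => u up; have [->|[l el _]] := ht u up.
  by rewrite scaler0.
by case: nl; exists l.
Qed.

Lemma nc_psi_morphism : psi_morphism (nc_cat K) n m.
Proof.
split=> /=.
- by move=> c a a' b; apply: val_inj; apply: tensDl.
- by move=> c a b b'; apply: val_inj; apply: tensDr.
- by apply: val_inj; apply: tens1.
- by move=> a a' b b'; apply: val_inj; apply: tensM.
- exact: nc_psi_deg.
Qed.

End NCMorphism.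

(* Main.v *)
Require Import Defs.
From HB Require Import structures.
From mathcomp Require Import all_boot all_order all_fingroup all_algebra.
From mathcomp Require Import mpoly.
From mathcomp Require Import zify.

Set Implicit Arguments.
Unset Strict Implicit.
Unset Printing Implicit Defensive.

Import GRing.Theory.
Local Open Scope ring_scope.

(** Everything rests on reading the Coxeter length as a number of inversions.
    With permutations composed from left to right, [srefl i * w] exchanges the
    values of [w] at [i] and [i.+1], so the length goes up exactly when
    [w i < w i.+1], an ascent.  Hence [edge_d i] sends [v_w] to [v_(s_i w)] at
    the ascents of [w], [edge_dm i] does so at the descents, and every assertion
    about these operators becomes one about a permutation seen as a function.

    Minimal categorification.  The graded dimension of the edge space is the
    generating function of inversions, which factors one position at a time:
    the position 0, carrying the value [k], contributes [k] inversions
    ([inversions_lift_perm]), and the resulting geometric sums are quantum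
    integers ([qint_sum]).  Minimal coset representatives are the permutations
    that increase on both blocks ([min_coset_repP]); the factorization is unique
    and lengths add, so that on the basis the map psi is literally
    [a (x) b (x) id] ([edge_psiE]).  Associativity holds because a permutation
    that increases on three consecutive blocks is a product of minimal
    representatives for either bracketing ([assoc_rep]).

    Generation.  Each [w] is reached from the identity through ascents, and from
    the longest element through descents, which gives the two cyclicity
    statements.  The idempotent [edge_dm i * edge_d i] projects onto the span of
    the [v_w] with an ascent at [i].  Only the identity ascends everywhere, so
    the product of these idempotents is the matrix unit at the identity
    ([edge_unit_one]), and multiplying it by [edge_d] on the left and [edge_dm]
    on the right produces every matrix unit.

    Three strands.  The degrees force any admissible choice on two strands to be
    [t d] and [t' d^-] with [t' t = 1].  For an arbitrary model [W_3] of the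
    representation, with top vector [v], the map [x |-> rho(E_(x,1)) v] is an
    isomorphism from the edge space onto [W_3] ([ts_thetaE]) once
    [rho(E_(1,1)) v = v] is known.  The graded dimension gives this: it confines
    the degrees of [W_3] to [-3 .. 3], so the nonzero operator
    [rho(E_(1,w_0))], of degree 6, has values on the line of [v].  It remains to
    read off the action on the six vectors [v_w] ([d_table], [dm_table]).

    No isomorphism with NC.  By degree an isomorphism matches the local
    generators up to scalars.  The idempotents [edge_dm i * edge_d i] are
    diagonal, hence commute; in NC the corresponding operators are
    [x_i d_i], and for [i = 1, 2] they do not commute on [x_2]
    ([nc_proj_not_comm]). *)

(** * Coxeter length and inversions *)

Section Inversions.
Variable n : nat.
Implicit Types (w : 'S_n) (i : 'I_n.-1).

Definition inversions w : nat :=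
  (\sum_(x < n) \sum_(y < n) ((x < y) && (w y < w x)))%N.

Lemma srefl_l i : srefl i (pos_l i) = pos_r i. Proof. exact: tpermL. Qed.
Lemma srefl_r i : srefl i (pos_r i) = pos_l i. Proof. exact: tpermR. Qed.

Lemma sreflK i w : (srefl i * (srefl i * w) = w)%g.
Proof. by rewrite mulgA /srefl tperm2 mul1g. Qed.

Lemma asc_or_desc w i :
  (w (pos_r i) < w (pos_l i))%N = ~~ (w (pos_l i) < w (pos_r i))%N.
Proof.
have : w (pos_l i) != w (pos_r i) by rewrite (inj_eq perm_inj) -val_eqE /= ltn_eqF.
by rewrite -val_eqE /=; lia.
Qed.

Lemma inversions_card w :
  inversions w = #|[set p : 'I_n * 'I_n | (p.1 < p.2) && (w p.2 < w p.1)]|%N.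
Proof.
rewrite /inversions pair_bigA /= -sum1_card [RHS]big_mkcond /=.
by apply: eq_bigr => p _; rewrite inE; case: (_ && _).
Qed.

(** Composition with [s_i] matches the inversions of [w] with those of
    [s_i w] other than the pair of positions [(i, i.+1)] itself. *)
Lemma inversions_asc w i : (w (pos_l i) < w (pos_r i))%N ->
  inversions (srefl i * w)%g = (inversions w).+1.
Proof.
move=> asc; rewrite !inversions_card; set A := [set p | _].
have lrA : (pos_l i, pos_r i) \in A.
  by rewrite inE /= !permM srefl_l srefl_r asc ltnS leqnn.
rewrite (cardsD1 (pos_l i, pos_r i)) lrA add1n; congr _.+1.
pose f (p : 'I_n * 'I_n) := (srefl i p.1, srefl i p.2).
have fI : injective f by move=> [x y] [x' y'] [/perm_inj-> /perm_inj->].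
(* [f] is a bijection, and it preserves the order of every pair of positions
   other than [(i, i.+1)] and its reverse *)
rewrite -(card_preimset _ fI); apply: eq_card => -[x y]; rewrite !inE /= !permM.
rewrite xpair_eqE.
have sP (z : 'I_n) : [\/ z = pos_l i, z = pos_r i |
    [/\ srefl i z = z, z <> i :> nat & z <> i.+1 :> nat]].
  rewrite /srefl; case: tpermP => [->|->|zl zr]; first by constructor 1.
    by constructor 2.
  by constructor 3; split=> // e; [apply: zl|apply: zr]; apply: val_inj.
have [->|->|[ex xl xr]] := sP x; have [->|->|[ey yl yr]] := sP y;
  rewrite ?ex ?ey ?srefl_l ?srefl_r ?srefl_l ?srefl_r -!val_eqE /= ?eqxx /=; lia.
Qed.

Lemma inversions_desc w i : (w (pos_r i) < w (pos_l i))%N ->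
  inversions w = (inversions (srefl i * w)%g).+1.
Proof.
move=> desc; rewrite -{1}(sreflK i w) inversions_asc //.
by rewrite !permM srefl_l srefl_r.
Qed.

Lemma inversions1 : inversions 1%g = 0%N.
Proof.
rewrite /inversions big1 // => x _; rewrite big1 // => y _; rewrite !perm1.
by apply/eqP; rewrite eqb0; lia.
Qed.

(** Increase along adjacent positions propagates; for a permutation this turns
    the absence of descents into monotonicity. *)
Lemma locally_increasing (f : 'I_n -> nat) :
  (forall i, f (pos_l i) < f (pos_r i))%N -> {homo f : x y / (x < y)%N}.
Proof.
move=> finc x y xy; have [k ek] : exists k, y = (x + k.+1)%N :> nat.
  by exists (y - x.+1)%N; lia.
elim: k y ek {xy} => [|k IH] y ek.
  have lti : (x < n.-1)%N by rewrite ltn_predRL; have := ltn_ord y; lia.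
  have -> : y = pos_r (Ordinal lti) by apply: val_inj; rewrite /= ek addn1.
  have {1}-> : x = pos_l (Ordinal lti) by apply: val_inj.
  exact: finc.
have lti : (x + k.+1 < n.-1)%N by rewrite ltn_predRL; have := ltn_ord y; lia.
apply: ltn_trans (IH (pos_l (Ordinal lti)) _) _ => //.
have -> : y = pos_r (Ordinal lti) by apply: val_inj; rewrite /= ek addnS.
exact: finc.
Qed.

Lemma increasing_ge w : {homo w : x y / (x < y)%N} -> forall x : 'I_n, (x <= w x)%N.
Proof.
move=> winc [k ltk]; elim: k ltk => //= k IH ltk.
by apply: leq_ltn_trans (IH (ltnW ltk)) _; apply: winc.
Qed.

Lemma increasing_perm w : {homo w : x y / (x < y)%N} -> w = 1%g.
Proof.
move=> winc; apply/permP => x; rewrite perm1; apply/val_inj/eqP.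
rewrite eqn_leq increasing_ge // andbT.
have := @increasing_ge w^-1%g _ (w x); rewrite permK; apply=> y z yz.
rewrite ltnNge leq_eqVlt; apply/negP => /orP[/eqP/val_inj/perm_inj|/winc].
  by move=> e; rewrite e ltnn in yz.
by rewrite !permKV; lia.
Qed.

Lemma no_descent w : (forall i, w (pos_l i) < w (pos_r i))%N -> w = 1%g.
Proof.
by move=> asc; apply: increasing_perm => x y; apply: (locally_increasing (f := fun z => w z)).
Qed.

(** If both permutations decrease, then [w^-1 * w'] increases, hence is trivial. *)
Lemma no_ascent_uniq w w' : (forall i, w (pos_r i) < w (pos_l i))%N ->
  (forall i, w' (pos_r i) < w' (pos_l i))%N -> w = w'.
Proof.
have dec (v : 'S_n) : (forall i, v (pos_r i) < v (pos_l i))%N ->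
    forall x y : 'I_n, (x < y)%N -> (v y < v x)%N.
  move=> dv x y xy.
  suff : (n - v x < n - v y)%N by lia.
  apply: (locally_increasing (f := fun z => (n - v z)%N)) => // i.
  by have := dv i; have := ltn_ord (v (pos_l i)); lia.
move=> /dec dw /dec dw'; apply/eqP; rewrite eq_mulVg1; apply/eqP/increasing_perm => x y xy.
rewrite !permM; apply: dw'.
rewrite ltnNge leq_eqVlt; apply/negP => /orP[/eqP/val_inj/perm_inj|/dw].
  by move=> e; rewrite e ltnn in xy.
by rewrite !permKV; lia.
Qed.

Lemma coxlen_word w : exists2 c : seq 'I_n.-1,
  size c = coxlen w & w = (\prod_(i <- c) srefl i)%g.
Proof.
rewrite /coxlen; case: ex_minnP => k /existsP[c /eqP ew] _.
by exists c; rewrite ?size_tuple.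
Qed.

Lemma coxlen_min (c : seq 'I_n.-1) : (coxlen (\prod_(i <- c) srefl i)%g <= size c)%N.
Proof.
rewrite /coxlen; case: ex_minnP => k _; apply; apply/existsP.
by exists (in_tuple c).
Qed.

Lemma inversions_prod_le (c : seq 'I_n.-1) : (inversions (\prod_(i <- c) srefl i)%g <= size c)%N.
Proof.
elim: c => [|i c IH]; first by rewrite big_nil inversions1.
rewrite big_cons /=; set w := (\prod_(j <- c) _)%g in IH *.
have [asc|/negPf] := boolP (w (pos_l i) < w (pos_r i))%N; first by rewrite inversions_asc.
by move/negbT; rewrite -asc_or_desc => /inversions_desc; lia.
Qed.

(** While there are inversions there is a descent, and removing it lowers their
    number by one. *)
Lemma inversions_word w : exists2 c : seq 'I_n.-1,
  size c = inversions w & w = (\prod_(i <- c) srefl i)%g.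
Proof.
elim: (inversions w) {-2}w (leqnn (inversions w)) => [|k IH] {}w le_wk.
  exists [::]; first by rewrite /=; lia.
  rewrite big_nil; apply: no_descent => i; rewrite ltnNge leq_eqVlt.
  apply/negP => /orP[/eqP/val_inj/perm_inj/(congr1 val)/=|/inversions_desc]; by lia.
have [[i desc]|none] := altP (@existsP _ (fun i => w (pos_r i) < w (pos_l i))%N).
  have e := inversions_desc desc.
  have [|c sc ec] := IH (srefl i * w)%g; first by lia.
  by exists (i :: c); rewrite /= ?sc // big_cons -ec sreflK.
have -> : w = 1%g.
  apply: no_descent => i; apply: contraNT none; rewrite -asc_or_desc => desc.
  by apply/existsP; exists i.
by exists [::]; rewrite ?inversions1 ?big_nil.
Qed.

(** A word of length [k] creates at most [k] inversions, and removing descents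
    one by one gives a word with exactly as many letters as inversions. *)
Lemma coxlenE w : coxlen w = inversions w.
Proof.
apply/eqP; rewrite eqn_leq; apply/andP; split.
  by have [c <- ->] := inversions_word w; apply: coxlen_min.
by have [c <- {1}->] := coxlen_word w; apply: inversions_prod_le.
Qed.

Lemma coxlen_srefl w i : coxlen (srefl i * w)%g =
  if (w (pos_l i) < w (pos_r i))%N then (coxlen w).+1 else (coxlen w).-1.
Proof.
rewrite !coxlenE; case: ifPn => [/inversions_asc//|]; rewrite -asc_or_desc => /inversions_desc ->.
by [].
Qed.

Lemma ascE w i :
  (coxlen (srefl i * w)%g == (coxlen w).+1) = (w (pos_l i) < w (pos_r i))%N.
Proof. by rewrite coxlen_srefl; case: ifP => // _; lia. Qed.

Lemma descE w i :
  ((coxlen (srefl i * w)%g).+1 == coxlen w) = (w (pos_r i) < w (pos_l i))%N.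
Proof.
rewrite asc_or_desc; case: (boolP (_ < _)%N) => [asc|].
  by rewrite coxlen_srefl asc; lia.
by rewrite -asc_or_desc => /inversions_desc; rewrite !coxlenE => ->; rewrite eqxx.
Qed.

Lemma coxlen_eq0 w : (coxlen w == 0%N) = (w == 1%g).
Proof.
apply/eqP/eqP => [|->]; last by rewrite coxlenE inversions1.
by have [c <- ->] := coxlen_word w => /size0nil ->; rewrite big_nil.
Qed.

Lemma longest_desc i : (longest n (pos_r i) < longest n (pos_l i))%N.
Proof.
rewrite /longest; case: arg_maxnP => // w _ wmax.
rewrite asc_or_desc; apply/negP => /inversions_asc e.
by have := wmax (srefl i * w)%g isT; rewrite /= !coxlenE e; lia.
Qed.

End Inversions.

(** * Minimal coset representatives *)

Section Blocks.
Variables n m : nat.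
Implicit Types u : 'S_(n + m).

Lemma par_l (w1 : 'S_n) (w2 : 'S_m) i : par w1 w2 (lshift m i) = lshift m (w1 i).
Proof. by rewrite permE /par_fun (unsplitK (inl i)). Qed.
Lemma par_r (w1 : 'S_n) (w2 : 'S_m) i : par w1 w2 (rshift n i) = rshift n (w2 i).
Proof. by rewrite permE /par_fun (unsplitK (inr i)). Qed.

Lemma perm_splitP u u' : (forall i, u (lshift m i) = u' (lshift m i)) ->
  (forall i, u (rshift n i) = u' (rshift n i)) -> u = u'.
Proof.
by move=> el er; apply/permP => x; case: (split_ordP x) => i ->.
Qed.

Lemma parM (w1 w1' : 'S_n) (w2 w2' : 'S_m) :
  (par w1 w2 * par w1' w2' = par (w1 * w1') (w2 * w2'))%g.
Proof. by apply: perm_splitP => i; rewrite permM ?par_l ?par_r permM. Qed.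

Lemma par1 : par 1 1 = 1%g :> 'S_(n + m).
Proof. by apply: perm_splitP => i; rewrite ?par_l ?par_r !perm1. Qed.

Lemma par_srefl_l i : par (srefl i) 1 = srefl (shl m i) :> 'S_(n + m).
Proof.
apply: perm_splitP => k; rewrite ?par_l ?par_r ?perm1.
  by rewrite srefl_shl_l.
by rewrite srefl_shl_r.
Qed.
Lemma par_srefl_r i : par 1 (srefl i) = srefl (shr n i) :> 'S_(n + m).
Proof.
apply: perm_splitP => k; rewrite ?par_l ?par_r ?perm1.
  by rewrite srefl_shr_l.
by rewrite srefl_shr_r.
Qed.

(** The concrete form of minimality in a coset of [S_n x S_m], see
    [min_coset_repP]. *)
Definition block_increasing u : Prop :=
  {homo (fun i => u (lshift m i)) : x y / (x < y)%N} /\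
  {homo (fun i => u (rshift n i)) : x y / (x < y)%N}.

(** The inversions between the two blocks, the only ones that the factor in
    [S_n x S_m] does not affect. *)
Definition cross_inversions u : nat :=
  (\sum_(x < n) \sum_(y < m) (u (rshift n y) < u (lshift m x)))%N.

Lemma increasing_ltn k N (f : 'I_k -> 'I_N) : {homo f : x y / (x < y)%N} ->
  {mono f : x y / (x < y)%N}.
Proof.
move=> finc x y; apply/idP/idP; last exact: finc.
by case: (ltngtP x y) => // [/finc|/val_inj->]; lia.
Qed.

(** As [u] preserves the order inside each block, the inversions inside the
    blocks are those of [w1] and [w2]; the pairs across the blocks are permuted
    among themselves by [par w1 w2]. *)
Lemma inversions_par_mul w1 w2 u : block_increasing u ->
  inversions (par w1 w2 * u)%g = (inversions w1 + inversions w2 + cross_inversions u)%N.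
Proof.
move=> [ul ur]; rewrite /inversions big_split_ord /=.
under eq_bigr => x _ do rewrite big_split_ord /=.
rewrite big_split /= -addnA -[RHS]addnA [in RHS](addnC _ (cross_inversions u)); congr (_ + (_ + _))%N.
- apply: eq_bigr => x _; apply: eq_bigr => y _.
  by rewrite !permM !par_l (increasing_ltn ul).
- rewrite /cross_inversions [RHS](reindex_inj (@perm_inj _ w1)); apply: eq_bigr => x _ /=.
  rewrite [RHS](reindex_inj (@perm_inj _ w2)); apply: eq_bigr => y _ /=.
  by rewrite !permM par_l par_r ltn_addr.
apply: eq_bigr => x _; rewrite big_split_ord /= big1 ?add0n; last first.
  by move=> y _; case: ltnP => //=; have := ltn_ord y; lia.
apply: eq_bigr => y _.
by rewrite !permM !par_r (increasing_ltn ur) ltn_add2l.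
Qed.

Lemma block_increasing1 : block_increasing 1%g.
Proof. by split=> x y xy; rewrite !perm1 /= ?ltn_add2l. Qed.

Lemma coxlen_par_mul w1 w2 u : block_increasing u ->
  coxlen (par w1 w2 * u)%g = (coxlen w1 + coxlen w2 + coxlen u)%N.
Proof.
move=> ui; rewrite !coxlenE inversions_par_mul //.
by rewrite -[in RHS](mul1g u) -par1 [in RHS]inversions_par_mul // !inversions1.
Qed.

(** A descent of [u] inside a block could be removed by a simple reflection of
    [S_n x S_m]; conversely lengths add over block-increasing elements. *)
Lemma min_coset_repP u : reflect (block_increasing u) (min_coset_rep u).
Proof.
apply: (iffP idP) => [/forallP min|ui]; last first.
  by apply/forallP => w1; apply/forallP => w2; rewrite coxlen_par_mul // leq_addl.
split=> x y; apply: (locally_increasing (f := fun i => u _)) => i.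
  have /forallP/(_ 1%g) := min (srefl i); rewrite par_srefl_l.
  rewrite -pos_l_shl -pos_r_shl !coxlenE; apply: contraLR.
  by rewrite -asc_or_desc => /inversions_desc ->; rewrite ltnn.
have /forallP/(_ (srefl i)) := min 1%g; rewrite par_srefl_r.
rewrite -pos_l_shr -pos_r_shr !coxlenE; apply: contraLR.
by rewrite -asc_or_desc => /inversions_desc ->; rewrite ltnn.
Qed.

Lemma par_factor (w : 'S_(n + m)) : exists w1 w2 u,
  block_increasing u /\ w = (par w1 w2 * u)%g.
Proof.
pose F (p : 'S_n * 'S_m) := coxlen (par p.1 p.2 * w)%g.
(* the representative is an element of least length in the coset *)
have [[v1 v2] _ min] := @arg_minnP _ (1%g, 1%g) xpredT F isT.
exists v1^-1%g, v2^-1%g, (par v1 v2 * w)%g; split; last first.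
  by rewrite mulgA parM !mulVg par1 mul1g.
apply/min_coset_repP/forallP => w1; apply/forallP => w2.
by rewrite mulgA parM; apply: (min ((w1 * v1)%g, (w2 * v2)%g)).
Qed.

(** Both [u] and [par w1 w2 * u] increase on a block only if [w1], [w2] do, and
    an increasing permutation is trivial. *)
Lemma block_increasing_inj w1 w2 u u' : block_increasing u -> block_increasing u' ->
  (par w1 w2 * u)%g = u' -> [/\ w1 = 1, w2 = 1 & u = u']%g.
Proof.
move=> [ul ur] [ul' ur'] e.
have e1 : w1 = 1%g.
  apply: increasing_perm => x y /ul'.
  by rewrite -e !permM !par_l (increasing_ltn ul).
have e2 : w2 = 1%g.
  apply: increasing_perm => x y /ur'.
  by rewrite -e !permM !par_r (increasing_ltn ur).
by split=> //; rewrite -e e1 e2 par1 mul1g.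
Qed.

Lemma par_factor_uniq w1 w2 u w1' w2' u' :
  block_increasing u -> block_increasing u' ->
  (par w1 w2 * u)%g = (par w1' w2' * u')%g -> [/\ w1 = w1', w2 = w2' & u = u'].
Proof.
move=> ui ui' /(congr1 (fun w => par w1'^-1 w2'^-1 * w)%g).
rewrite !mulgA !parM !mulVg par1 mul1g.
move=> /(block_increasing_inj ui ui')[/eqP + /eqP + ->].
by rewrite -!eq_mulVg1 => /eqP -> /eqP ->.
Qed.

End Blocks.

(** * The operators on the edge spaces *)

(** [linfun] accepts any function; this gives back its values from a proof of
    linearity, when the function carries no canonical linear structure. *)
Lemma linfun_linearE (K : fieldType) (U V : vectType K) (f : U -> V) :
  linear f -> linfun f =1 f.
Proof.
move=> f_lin; pose g : {linear U -> V} := HB.pack f (GRing.isLinear.Build K U V *:%R f f_lin).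
exact: (lfunE g).
Qed.

Lemma linear_combination (K : fieldType) (U V : lmodType K) (f : U -> V) : linear f ->
  forall (I : finType) (c : I -> K) (x : I -> U),
  f (\sum_i c i *: x i) = \sum_i c i *: f (x i).
Proof.
move=> f_lin I c x.
pose g : {linear U -> V} := HB.pack f (GRing.isLinear.Build K U V *:%R f f_lin).
rewrite -[f]/(g : U -> V) linear_sum.
by apply: eq_bigr => i _; rewrite linearZ.
Qed.

Lemma linear_fun_sum (K : fieldType) (U V : lmodType K) (f : U -> V) : linear f ->
  forall (I : finType) (x : I -> U), f (\sum_i x i) = \sum_i f (x i).
Proof.
move=> f_lin I x; transitivity (f (\sum_i 1 *: x i)).
  by congr f; apply: eq_bigr => i _; rewrite scale1r.
by rewrite linear_combination //; apply: eq_bigr => i _; rewrite scale1r.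
Qed.

Lemma linear_funZ (K : fieldType) (U V : lmodType K) (f : U -> V) : linear f ->
  forall c x, f (c *: x) = c *: f x.
Proof.
move=> f_lin c x; have f0 : f 0 = 0.
  by rewrite -{1}(addNr (0 : U)) -scaleN1r f_lin scaleN1r addNr.
by rewrite -[c *: x]addr0 f_lin f0 addr0.
Qed.

Section EdgeOperators.
Variables (K : fieldType) (n : nat).
Implicit Types (a b : edge_alg K n) (x : edgeW K n) (w v : 'S_n) (i : 'I_n.-1).

Local Notation ev := (edgev K).

HB.instance Definition _ a := GRing.Linear.copy (edge_app a) (fun_of_lfun a).

Lemma edgevE w v : ev w v = (v == w)%:R. Proof. by rewrite ffunE. Qed.

Lemma edge_expand x : x = \sum_w x w *: ev w.
Proof.
apply/ffunP => v; rewrite sum_ffunE (bigD1 v) //= big1 ?addr0.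
  by rewrite !ffunE eqxx; rewrite /GRing.scale /= mulr1.
by move=> w /negPf nwv; rewrite !ffunE eq_sym nwv /GRing.scale /= mulr0.
Qed.

Lemma edge_app_expand a x : edge_app a x = \sum_w x w *: edge_app a (ev w).
Proof. by rewrite {1}(edge_expand x) linear_sum; apply: eq_bigr => w _; rewrite linearZ. Qed.

Lemma edge_ext a b : (forall w, edge_app a (ev w) = edge_app b (ev w)) -> a = b.
Proof.
move=> ab; apply/lfunP => x; change (edge_app a x = edge_app b x).
by rewrite !(edge_app_expand _ x); apply: eq_bigr => w _; rewrite ab.
Qed.

Lemma edge_mulE a b x : edge_app (a * b) x = edge_app a (edge_app b x).
Proof. exact: comp_lfunE. Qed.
Lemma edge_1E x : edge_app 1 x = x.
Proof. exact: id_lfunE. Qed.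
Lemma edge_linE c a b x : edge_app (c *: a + b) x = c *: edge_app a x + edge_app b x.
Proof. by rewrite /edge_app add_lfunE scale_lfunE. Qed.
Lemma edge_addE a b x : edge_app (a + b) x = edge_app a x + edge_app b x.
Proof. exact: add_lfunE. Qed.
Lemma edge_scaleE c a x : edge_app (c *: a) x = c *: edge_app a x.
Proof. exact: scale_lfunE. Qed.
Lemma edge_0E x : edge_app 0 x = 0.
Proof. exact: zero_lfunE. Qed.

Definition edge_of (f : 'S_n -> edgeW K n) : edge_alg K n :=
  linfun (fun x : edgeW K n => \sum_w x w *: f w).

Lemma sum_coef_linear (f : 'S_n -> edgeW K n) :
  linear (fun x : edgeW K n => \sum_w x w *: f w).
Proof.
move=> c x y; rewrite scaler_sumr -big_split; apply: eq_bigr => w _ /=.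
by rewrite !ffunE scalerDl scalerA.
Qed.

Lemma sum_coef_edgev (f : 'S_n -> edgeW K n) v : \sum_w ev v w *: f w = f v.
Proof.
rewrite (bigD1 v) //= edgevE eqxx scale1r big1 ?addr0 // => w /negPf nwv.
by rewrite edgevE nwv scale0r.
Qed.

Lemma edge_ofE f w : edge_app (edge_of f) (ev w) = f w.
Proof.
by rewrite /edge_app /edge_of (linfun_linearE (sum_coef_linear f)) sum_coef_edgev.
Qed.

Lemma linfun_edge_of (g : edgeW K n -> edgeW K n) f :
  (forall x, g x = \sum_w x w *: f w) -> linfun g = edge_of f :> edge_alg K n.
Proof.
move=> gf; apply/lfunP => x.
rewrite !linfun_linearE //; first exact: sum_coef_linear.
by move=> c y z; rewrite !gf sum_coef_linear.
Qed.

Lemma edge_dE i w : edge_app (edge_d K i) (ev w) =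
  if (w (pos_l i) < w (pos_r i))%N then ev (srefl i * w)%g else 0.
Proof.
rewrite /edge_d (linfun_edge_of (f := fun w =>
  if (w (pos_l i) < w (pos_r i))%N then ev (srefl i * w)%g else 0)) ?edge_ofE //.
by move=> x; apply: eq_bigr => v _; rewrite ascE; case: ifP => // _; rewrite scaler0.
Qed.

Lemma edge_dmE i w : edge_app (edge_dm K i) (ev w) =
  if (w (pos_r i) < w (pos_l i))%N then ev (srefl i * w)%g else 0.
Proof.
rewrite /edge_dm (linfun_edge_of (f := fun w =>
  if (w (pos_r i) < w (pos_l i))%N then ev (srefl i * w)%g else 0)) ?edge_ofE //.
by move=> x; apply: eq_bigr => v _; rewrite descE; case: ifP => // _; rewrite scaler0.
Qed.

Lemma edgev_neq0 w : ev w != 0.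
Proof.
by apply/eqP => /ffunP/(_ w)/eqP; rewrite edgevE ffunE eqxx oner_eq0.
Qed.

Lemma edge_d_sq i : edge_d K i ^+ 2 = 0.
Proof.
apply: edge_ext => w; rewrite expr2 edge_mulE edge_0E edge_dE.
case: ifP => [asc|]; last by rewrite linear0.
by rewrite edge_dE !permM srefl_l srefl_r asc_or_desc asc.
Qed.

Lemma edge_dm_sq i : edge_dm K i ^+ 2 = 0.
Proof.
apply: edge_ext => w; rewrite expr2 edge_mulE edge_0E edge_dmE.
case: ifP => [desc|]; last by rewrite linear0.
by rewrite edge_dmE !permM srefl_l srefl_r ltnNge ltnW.
Qed.

(** The local idempotents are diagonal, which makes them commute; this is what
    distinguishes them from their polynomial analogues. *)
Lemma edge_dmdE i w : edge_app (edge_dm K i * edge_d K i) (ev w) =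
  if (w (pos_l i) < w (pos_r i))%N then ev w else 0.
Proof.
rewrite edge_mulE edge_dE; case: ifP => asc; last by rewrite linear0.
by rewrite edge_dmE !permM srefl_l srefl_r asc sreflK.
Qed.

Lemma edge_ddm i : edge_d K i * edge_dm K i + edge_dm K i * edge_d K i = 1.
Proof.
apply: edge_ext => w; rewrite edge_addE edge_dmdE edge_1E edge_mulE edge_dmE.
rewrite asc_or_desc; case: (boolP (w _ < _)%N) => [_|desc] /=.
  by rewrite linear0 add0r.
by rewrite edge_dE !permM srefl_l srefl_r asc_or_desc desc sreflK addr0.
Qed.

Lemma edge_dmd_comm i j :
  edge_dm K i * edge_d K i * (edge_dm K j * edge_d K j) =
  edge_dm K j * edge_d K j * (edge_dm K i * edge_d K i).
Proof.
have proj_if k (c : bool) w :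
    edge_app (edge_dm K k * edge_d K k) (if c then ev w else 0) =
    if (w (pos_l k) < w (pos_r k))%N && c then ev w else 0.
  by case: c; rewrite ?andbT ?andbF ?linear0 ?edge_dmdE.
apply: edge_ext => w; apply: etrans (edge_mulE _ _ _) (etrans _ (esym (edge_mulE _ _ _))).
by rewrite !edge_dmdE !proj_if andbC.
Qed.

Definition edge_unit w v : edge_alg K n := edge_of (fun v' => if v' == v then ev w else 0).

Lemma edge_unitE w v v' : edge_app (edge_unit w v) (ev v') = if v' == v then ev w else 0.
Proof. exact: edge_ofE. Qed.

Lemma edge_sumE (I : Type) (r : seq I) (P : pred I) (F : I -> edge_alg K n) x :
  edge_app (\sum_(j <- r | P j) F j) x = \sum_(j <- r | P j) edge_app (F j) x.
Proof. exact: (big_morph (fun a => edge_app a x) (fun a b => edge_addE a b x) (edge_0E x)). Qed.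

Lemma edge_alg_expand a : a = \sum_v \sum_w edge_app a (ev v) w *: edge_unit w v.
Proof.
apply: edge_ext => v; rewrite edge_sumE (bigD1 v) //= edge_sumE [X in _ + X]big1.
  rewrite addr0 {1}[edge_app a _]edge_expand; apply: eq_bigr => w _.
  by rewrite edge_scaleE edge_unitE eqxx.
move=> v' nv; rewrite edge_sumE big1 // => w _.
by rewrite edge_scaleE edge_unitE eq_sym (negPf nv) scaler0.
Qed.

Lemma edge_d_unit w v i : (w (pos_l i) < w (pos_r i))%N ->
  edge_d K i * edge_unit w v = edge_unit (srefl i * w)%g v.
Proof.
move=> asc; apply: edge_ext => v'; rewrite edge_mulE !edge_unitE.
by case: eqP => _; rewrite ?linear0 // edge_dE asc.
Qed.

Lemma edge_unit_dm w v i : (v (pos_l i) < v (pos_r i))%N ->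
  edge_unit w v * edge_dm K i = edge_unit w (srefl i * v)%g.
Proof.
move=> asc; apply: edge_ext => v'; rewrite edge_mulE edge_dmE edge_unitE.
have -> : (v' == srefl i * v)%g = (srefl i * v' == v)%g.
  by apply/eqP/eqP => [->|<-]; rewrite sreflK.
case: ifP => [desc|]; first by rewrite edge_unitE.
move: asc; rewrite linear0; case: eqP => // <-.
by rewrite !permM srefl_l srefl_r => ->.
Qed.

Lemma edge_unit_mul w v v' w' :
  edge_unit w v * edge_unit v' w' = if v' == v then edge_unit w w' else 0.
Proof.
apply: edge_ext => u; rewrite edge_mulE edge_unitE.
case: (u =P w') => [->|/eqP/negPf nu]; rewrite ?edge_unitE.
  by case: ifP; rewrite ?edge_0E // edge_unitE eqxx.
by rewrite linear0; case: ifP; rewrite ?edge_0E // edge_unitE nu.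
Qed.

(** Only the identity has an ascent at every position. *)
Lemma edge_unit_one :
  edge_unit 1 1 = \prod_(i <- enum 'I_n.-1) (edge_dm K i * edge_d K i).
Proof.
apply: edge_ext => w; rewrite edge_unitE.
transitivity (if w == 1%g then ev w else 0); first by case: eqP => [->|].
have -> : (w == 1%g) = all (fun i => w (pos_l i) < w (pos_r i))%N (enum 'I_n.-1).
  apply/eqP/allP => [-> i _|asc]; first by rewrite !perm1 /= ltnS.
  by apply: no_descent => i; apply: asc; rewrite mem_enum.
elim: (enum _) => [|i c IH]; first by rewrite big_nil edge_1E /=.
rewrite big_cons edge_mulE -IH /=; case: (all _ _); rewrite ?andbT ?andbF.
  by rewrite edge_dmdE.
by rewrite linear0.
Qed.

(** A permutation other than the identity has a descent; undoing it is a shorter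
    case. *)
Lemma ascent_ind (P : 'S_n -> Prop) : P 1%g ->
  (forall w i, (w (pos_l i) < w (pos_r i))%N -> P w -> P (srefl i * w)%g) ->
  forall w, P w.
Proof.
move=> P1 PS w; elim: (inversions w) {-2}w (erefl (inversions w)) => [|k IH] {}w ew.
  by move/eqP: ew; rewrite -coxlenE coxlen_eq0 => /eqP ->.
have [asc|] := altP (@forallP _ (fun i => w (pos_l i) < w (pos_r i))%N).
  by rewrite (no_descent asc).
rewrite negb_forall => /existsP[i]; rewrite -asc_or_desc => desc.
rewrite -(sreflK i w); apply: PS; first by rewrite !permM srefl_l srefl_r.
by apply: IH; have := inversions_desc desc; rewrite ew => -[].
Qed.

(** A permutation other than the longest one has an ascent, because a permutation
    that decreases everywhere is unique. *)
Lemma descent_ind (P : 'S_n -> Prop) : P (longest n) ->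
  (forall w i, (w (pos_r i) < w (pos_l i))%N -> P w -> P (srefl i * w)%g) ->
  forall w, P w.
Proof.
move=> P1 PS w.
have le_long v : (inversions v <= inversions (longest n))%N.
  by rewrite -!coxlenE /longest; case: arg_maxnP => // u _; apply.
elim: (_ - inversions w)%N {-2}w (erefl (inversions (longest n) - inversions w)%N) => [|k IH] {}w ew;
  have [desc|] := altP (@forallP _ (fun i => w (pos_r i) < w (pos_l i))%N);
  try by rewrite (no_ascent_uniq desc (@longest_desc n)).
  rewrite negb_forall => /existsP[i]; rewrite asc_or_desc negbK => /inversions_asc e.
  by have := le_long (srefl i * w)%g; lia.
rewrite negb_forall => /existsP[i]; rewrite asc_or_desc negbK => asc.
rewrite -(sreflK i w); apply: PS; first by rewrite !permM srefl_l srefl_r.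
by apply: IH; have := inversions_asc asc; lia.
Qed.

Section Generation.
Variable S : edge_alg K n -> Prop.

Lemma gen_subalg_gen a : S a -> gen_subalg S a.
Proof. by move=> Sa B _; apply. Qed.
Lemma gen_subalg1 : gen_subalg S 1.
Proof. by move=> B []. Qed.
Lemma gen_subalg_lin c a b : gen_subalg S a -> gen_subalg S b -> gen_subalg S (c *: a + b).
Proof. by move=> ga gb B cB sB; have [_ BL _] := cB; apply: BL; [apply: ga|apply: gb]. Qed.
Lemma gen_subalgM a b : gen_subalg S a -> gen_subalg S b -> gen_subalg S (a * b).
Proof. by move=> ga gb B cB sB; have [_ _ BM] := cB; apply: BM; [apply: ga|apply: gb]. Qed.
Lemma gen_subalg0 : gen_subalg S 0.
Proof. by rewrite -(addNr 1) -scaleN1r; apply: gen_subalg_lin; apply: gen_subalg1. Qed.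
Lemma gen_subalg_sum (I : finType) (c : I -> K) (F : I -> edge_alg K n) :
  (forall j, gen_subalg S (F j)) -> gen_subalg S (\sum_j c j *: F j).
Proof.
move=> gF; elim/big_rec: _ => [|j a _ ga]; first exact: gen_subalg0.
exact: gen_subalg_lin.
Qed.

Lemma gen_subalg_reach x0 :
  (forall w, exists2 a, gen_subalg S a & edge_app a x0 = ev w) ->
  forall x, exists2 a, gen_subalg S a & edge_app a x0 = x.
Proof.
move=> reach x; have [f gf fE] := fin_all_exists2 reach.
exists (\sum_w x w *: f w); first exact: gen_subalg_sum.
rewrite edge_sumE [RHS]edge_expand; apply: eq_bigr => w _.
by rewrite edge_scaleE fE.
Qed.

(** From the matrix unit at the identity, left multiplications by [edge_d] move
    the row index and right multiplications by [edge_dm] the column index, both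
    along ascents. *)
Lemma gen_subalg_all : (forall i, S (edge_d K i)) -> (forall i, S (edge_dm K i)) ->
  forall a, gen_subalg S a.
Proof.
move=> Sd Sdm.
have unit_gen w v : gen_subalg S (edge_unit w v).
  elim/ascent_ind: w => [|w i asc IH].
    elim/ascent_ind: v => [|v i asc IH].
      rewrite edge_unit_one; elim/big_ind: _ => [|a b|i _].
      - exact: gen_subalg1.
      - exact: gen_subalgM.
      by apply: gen_subalgM; apply: gen_subalg_gen.
    by rewrite -edge_unit_dm //; apply: gen_subalgM => //; apply: gen_subalg_gen.
  by rewrite -edge_d_unit //; apply: gen_subalgM => //; apply: gen_subalg_gen.
move=> a; rewrite [a]edge_alg_expand.
under eq_bigr => v _ do rewrite -[\sum_w _]scale1r.
by apply: gen_subalg_sum => v; apply: gen_subalg_sum.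
Qed.
End Generation.

Lemma edge_plus_reach x : exists2 a, edge_plus a & edge_app a (ev 1%g) = x.
Proof.
apply: gen_subalg_reach => w; elim/ascent_ind: w => [|w i asc [a ga ea]].
  by exists 1; [exact: gen_subalg1|rewrite edge_1E].
exists (edge_d K i * a); last by rewrite edge_mulE ea edge_dE asc.
by apply: gen_subalgM => //; apply: gen_subalg_gen; exists i.
Qed.

Lemma edge_minus_reach x : exists2 a, edge_minus a & edge_app a (ev (longest n)) = x.
Proof.
apply: gen_subalg_reach => w; elim/descent_ind: w => [|w i desc [a ga ea]].
  by exists 1; [exact: gen_subalg1|rewrite edge_1E].
exists (edge_dm K i * a); last by rewrite edge_mulE ea edge_dmE desc.
by apply: gen_subalgM => //; apply: gen_subalg_gen; exists i.
Qed.

End EdgeOperators.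


(** * The grading and its graded dimension *)

Lemma perm_image_predC (T : finType) (S : eqType) (f : T -> S) (P : pred T) :
  perm_eq ([seq f x | x in P] ++ [seq f x | x in [predC P]]) [seq f x | x : T].
Proof.
have enumE (Q : pred T) : enum Q = filter Q (enum T) by rewrite enumT; apply: eq_filter.
by rewrite -map_cat (enumE P) (enumE [predC P]) perm_map // perm_filterC.
Qed.

Section EdgeGrading.
Variables (K : fieldType) (n : nat).
Implicit Types (x : edgeW K n) (w v : 'S_n) (d : int).
Local Notation ev := (@edgev K n).

(** The vectors supported in degree [d] are the kernel of the projection [F] that
    forgets the coordinates of degree [d], which bounds the span from above. *)
Lemma edgeW_compP x d :
  reflect (forall w, x w != 0 -> edge_wt w = d) (x \in edgeW_comp K n d).
Proof.
pose F x : edgeW K n := [ffun w => if edge_wt w == d then 0 else x w].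
have F_lin : linear F.
  move=> c y z; apply/ffunP => w; rewrite !ffunE; case: ifP => // _.
  by rewrite scaler0 addr0.
have FE := linfun_linearE F_lin.
have sub : (edgeW_comp K n d <= lker (linfun F))%VS.
  apply/span_subvP => _ /imageP[w wd ->]; rewrite memv_ker FE; apply/eqP/ffunP => v.
  rewrite !ffunE; case: eqP => // nv; case: eqP => // evw.
  by case: nv; rewrite evw; apply/eqP.
apply: (iffP idP) => [/(subvP sub) | xd].
  rewrite memv_ker FE => /eqP/ffunP Fx w; have := Fx w; rewrite !ffunE.
  by case: eqP => // _ ->; rewrite eqxx.
rewrite [x]edge_expand; apply: rpred_sum => w _.
have [->|/xd/eqP wd] := eqVneq (x w) 0; first by rewrite scale0r mem0v.
by apply: rpredZ; apply/memv_span/image_f.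
Qed.

Lemma edgev_span : (fullv <= <<[seq ev w | w : 'S_n]>>)%VS.
Proof.
apply/subvP => x _; rewrite [x]edge_expand; apply: rpred_sum => w _.
by apply: rpredZ; apply/memv_span/image_f.
Qed.

Lemma edgev_free : free [seq ev w | w : 'S_n].
Proof.
apply: (@basis_free _ _ fullv); rewrite basisEdim edgev_span size_image dimvf.
rewrite [X in (_ <= X)%N](_ : _ = #|{: 'S_n}| * 1)%N // muln1.
exact/eq_leq/eq_card.
Qed.

Lemma dim_edgeW_comp d : \dim (edgeW_comp K n d) = #|[pred w : 'S_n | edge_wt w == d]|.
Proof.
rewrite -(size_image ev); apply/eqP; rewrite -/(free _) /image_mem.
apply: (@catl_free _ _ [seq ev w | w in [predC [pred w : 'S_n | edge_wt w == d]]]).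
by apply: etrans edgev_free; apply: perm_free; apply: perm_image_predC.
Qed.

Definition edge_degs : seq int := undup [seq edge_wt w | w : 'S_n].

Lemma sum_edge_degs (V : nmodType) (F : int -> V) :
  \sum_(d <- edge_degs) F d *+ #|[pred w : 'S_n | edge_wt w == d]| = \sum_(w : 'S_n) F (edge_wt w).
Proof.
transitivity (\sum_(d <- edge_degs) \sum_(w : 'S_n | edge_wt w == d) F (edge_wt w)).
  by apply: eq_bigr => d _; rewrite -sumr_const; apply: eq_bigr => w /eqP ->.
rewrite (exchange_big_dep xpredT) //=; apply: eq_bigr => w _.
rewrite big_const_seq (eq_count (a2 := pred1 (edge_wt w))) => [|d]; last exact: eq_sym.
rewrite count_uniq_mem ?undup_uniq // mem_undup image_f //= addr0.
by [].
Qed.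

Lemma edge_grading : grading (@edgeW_comp K n) edge_degs.
Proof.
have sum_full : (\sum_(d <- edge_degs) edgeW_comp K n d)%VS = fullv.
  apply/eqP; rewrite eqEsubv subvf /=; apply/subvP => x _.
  rewrite [x]edge_expand; apply: rpred_sum => w _; apply: rpredZ.
  have wd : edge_wt w \in edge_degs by rewrite mem_undup image_f.
  rewrite (big_rem _ wd) /=; apply/(subvP (addvSl _ _))/memv_span/image_f.
  by rewrite inE.
split=> //; first exact: undup_uniq.
  move=> d; rewrite mem_undup => nd; apply/eqP; rewrite -subv0.
  apply/subvP => x /edgeW_compP xd; rewrite memv0; apply/eqP/ffunP => w.
  rewrite ffunE; apply/eqP/negPn/negP => /xd ewd.
  by rewrite -ewd image_f in nd.
rewrite directvE /= sum_full dimvf.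
under eq_bigr => d _ do rewrite dim_edgeW_comp.
have dimE : dim (edgeW K n) = #|{: 'S_n}|.
  rewrite [LHS](_ : _ = #|{: 'S_n}| * 1)%N // muln1.
  exact/eq_card.
have := sum_edge_degs (fun=> 1%N); rewrite sum1_card dimE => <-.
have natmul (k : nat) : (1%N : nat) *+ k = k by elim: k => // k IHk; rewrite mulrS IHk.
by apply/eqP/eq_bigr => d _; rewrite natmul.
Qed.

Lemma edge_graded_dim :
  graded_dim (@edgeW_comp K n) edge_degs = \sum_(w : 'S_n) qvar ^ edge_wt w.
Proof.
rewrite -(sum_edge_degs (fun d => qvar ^ d)).
by apply: eq_bigr => d _; rewrite dim_edgeW_comp mulr_natl.
Qed.

End EdgeGrading.

(** The position 0 has the value [k], and exactly [k] of the later values are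
    smaller; deleting it leaves [s]. *)
Lemma inversions_lift_perm n (k : 'I_n.+1) (s : 'S_n) :
  inversions (lift_perm ord0 k s) = (k + inversions s)%N.
Proof.
rewrite /inversions big_ord_recl lift_perm_id; congr (_ + _)%N.
  rewrite big_ord_recl ltnn add0n.
  under eq_bigr => y _ do rewrite lift_perm_lift /=.
  rewrite -(reindex_inj (@perm_inj _ s) (P := xpredT)
    (F := fun y => (lift k y < k)%N : nat)) //=.
  transitivity (\sum_(y < n | y < k) 1)%N.
    rewrite [RHS]big_mkcond; apply: eq_bigr => y _.
    by rewrite /= /bump; case: (ltnP y k) => yk; case: ltnP => //=; lia.
  by rewrite -(big_ord_widen n (fun=> 1%N)) ?sum1_card ?card_ord // -ltnS.
apply: eq_bigr => x _; rewrite big_ord_recl /= add0n.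
apply: eq_bigr => y _; rewrite !lift_perm_lift /=; congr (nat_of_bool (_ && _)).
by rewrite /bump; lia.
Qed.

Lemma sum_lift_perm n (V : nmodType) (F : 'S_n.+1 -> V) :
  \sum_w F w = \sum_(k < n.+1) \sum_(s : 'S_n) F (lift_perm ord0 k s).
Proof.
rewrite pair_bigA /=.
pose h (p : 'I_n.+1 * 'S_n) := lift_perm ord0 p.1 p.2.
have h_inj : injective h.
  move=> [k s] [k' s'] e; have ek : k = k'.
    by have /permP/(_ ord0) := e; rewrite !lift_perm_id.
  congr pair => //; subst k'; apply/permP => x; have /permP/(_ (lift ord0 x)) := e.
  by rewrite !lift_perm_lift => /lift_inj.
rewrite (reindex h) //; apply/onW_bij/inj_card_bij => //.
by rewrite card_prod card_ord !card_Sn factS.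
Qed.


Lemma qvar_neq0 : qvar != 0.
Proof. by rewrite tofrac_eq0 polyX_eq0. Qed.

Lemma subV_neq0 (F : fieldType) (q : F) : q ^+ 2 != 1 -> q != 0 -> q - q^-1 != 0.
Proof.
move=> q2 q0; apply: contra q2; rewrite subr_eq0 => /eqP e.
by rewrite expr2 {2}e mulfV.
Qed.

(** Multiplied by [q - q^-1], the sum telescopes. *)
Lemma telescope_qint (F : fieldType) (q : F) (k : nat) : q != 0 ->
  (\sum_(j < k.+1) q ^ (k%:Z - 2 * j%:Z)) * (q - q^-1) = q ^+ k.+1 - q ^- k.+1.
Proof.
move=> q0; pose f (j : nat) := - q ^ (k.+1%:Z - 2 * j%:Z).
have fE (j : nat) : q ^ (k%:Z - 2 * j%:Z) * (q - q^-1) = f j.+1 - f j.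
  have up d : q ^ d * q = q ^ (d + 1) by rewrite expfzDr.
  have dn d : q ^ d / q = q ^ (d - 1) by rewrite expfzDr.
  rewrite mulrBr up dn /f opprK addrC.
  by congr (- q ^ _ + q ^ _); lia.
rewrite mulr_suml; under eq_bigr => j _ do rewrite fE.
rewrite -(big_mkord xpredT (fun j => f j.+1 - f j)) telescope_sumr // /f opprK addrC.
by rewrite mulr0 subr0 exprnN; congr (_ - q ^ _); lia.
Qed.

Lemma qvar_sub_neq0 : qvar - qvar^-1 != 0.
Proof.
apply: subV_neq0 qvar_neq0; rewrite -tofracXn -tofrac1 tofrac_eq.
by apply/eqP => /(congr1 (size \o val)) /=; rewrite size_polyXn size_poly1.
Qed.

Lemma qint_sum k : \sum_(j < k.+1) qvar ^ (k%:Z - 2 * j%:Z) = qint k.+1.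
Proof.
by apply: (mulIf qvar_sub_neq0); rewrite (telescope_qint _ qvar_neq0) divfK ?qvar_sub_neq0.
Qed.

Lemma sum_qvar_wt n : \sum_(w : 'S_n) qvar ^ edge_wt w = qfact n.
Proof.
elim: n => [|n IH].
  rewrite /qfact big_geq // (bigD1 1%g) //= big1 ?addr0 => [|w /eqP[]].
    by rewrite /edge_wt coxlenE inversions1.
  by apply/permP => -[].
rewrite sum_lift_perm /qfact big_nat_recr //= -/(qfact n) -IH -qint_sum mulrC mulr_suml.
apply: eq_bigr => k _; rewrite mulr_sumr; apply: eq_bigr => s _.
rewrite -expfzDr ?qvar_neq0 //; congr (_ ^ _).
by rewrite /edge_wt !coxlenE inversions_lift_perm binS bin1 !PoszD; lia.
Qed.


(** * The maps psi *)

Section EdgePsi.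
Variables (K : fieldType) (n m : nat).
Local Notation ev := (edgev K).

(** By unique factorization, distinct indices in the sum that defines the glued
    vector give distinct basis vectors. *)
Lemma edge_glueE (x : edgeW K n) (y : edgeW K m) (u u' : 'S_(n + m)) w1 w2 :
  block_increasing u -> block_increasing u' ->
  edge_glue x y u (par w1 w2 * u')%g = if u' == u then x w1 * y w2 else 0.
Proof.
move=> ui ui'; rewrite /edge_glue sum_ffunE.
under eq_bigr => v1 _ do rewrite sum_ffunE.
rewrite (bigD1 w1) //= [X in _ + X]big1 ?addr0 => [|v1 /eqP nv1]; last first.
  apply: big1 => v2 _; rewrite ffunE edgevE.
  by case: eqP => [/(par_factor_uniq ui' ui)[e]|_]; [case: nv1|rewrite scaler0].
rewrite (bigD1 w2) //= big1 ?addr0 => [|v2 /eqP nv2]; last first.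
  rewrite ffunE edgevE.
  by case: eqP => [/(par_factor_uniq ui' ui)[_ e]|_]; [case: nv2|rewrite scaler0].
rewrite ffunE edgevE; case: eqP => [/(par_factor_uniq ui' ui)[_ _ ->]|nu].
  by rewrite eqxx /GRing.scale /= mulr1.
by case: eqP => [e|_]; [case: nu; rewrite e|rewrite scaler0].
Qed.

Lemma edge_glue_linl (y : edgeW K m) u : linear (fun x : edgeW K n => edge_glue x y u).
Proof.
move=> c x x'; rewrite /edge_glue scaler_sumr -big_split; apply: eq_bigr => w1 _ /=.
rewrite scaler_sumr -big_split; apply: eq_bigr => w2 _ /=.
by rewrite !ffunE scalerA -scalerDl mulrDl -scalerAl.
Qed.

Lemma edge_glue_linr (x : edgeW K n) u : linear (fun y : edgeW K m => edge_glue x y u).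
Proof.
move=> c y y'; rewrite /edge_glue scaler_sumr -big_split; apply: eq_bigr => w1 _ /=.
rewrite scaler_sumr -big_split; apply: eq_bigr => w2 _ /=.
by rewrite !ffunE scalerA -scalerDl mulrDr -scalerAr.
Qed.

Lemma edge_glue_expand (x : edgeW K n) (y : edgeW K m) u (f : 'S_n -> edgeW K n)
    (g : 'S_m -> edgeW K m) :
  edge_glue (\sum_w1 x w1 *: f w1) (\sum_w2 y w2 *: g w2) u =
  \sum_w1 \sum_w2 (x w1 * y w2) *: edge_glue (f w1) (g w2) u.
Proof.
transitivity (\sum_w1 x w1 *: edge_glue (f w1) (\sum_w2 y w2 *: g w2) u).
  exact: (linear_combination (edge_glue_linl _ u)).
apply: eq_bigr => w1 _.
transitivity (x w1 *: \sum_w2 y w2 *: edge_glue (f w1) (g w2) u).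
  by congr (_ *: _); exact: (linear_combination (edge_glue_linr _ u)).
rewrite scaler_sumr.
by apply: eq_bigr => w2 _; rewrite scalerA.
Qed.

Lemma edge_glue_edgev w1 w2 u :
  edge_glue (ev w1) (ev w2) u = ev (par w1 w2 * u : 'S_(n + m))%g.
Proof.
rewrite /edge_glue (bigD1 w1) //= [X in _ + X]big1 ?addr0 => [|v1 nv1]; last first.
  by apply: big1 => v2 _; rewrite [ev w1 v1]edgevE (negPf nv1) mul0r scale0r.
rewrite (bigD1 w2) //= big1 ?addr0 => [|v2 nv2]; last first.
  by rewrite [ev w2 v2]edgevE (negPf nv2) mulr0 scale0r.
by rewrite !edgevE !eqxx mulr1 scale1r.
Qed.

Lemma edge_psi_linear (a : edge_alg K n) (b : edge_alg K m) :
  linear (fun f : edgeW K (n + m) =>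
    \sum_(u : 'S_(n + m) | min_coset_rep u) \sum_(w1 : 'S_n) \sum_(w2 : 'S_m)
      f (par w1 w2 * u)%g *:
        edge_glue (edge_app a (edgev K w1)) (edge_app b (edgev K w2)) u).
Proof.
move=> c x y; rewrite scaler_sumr -big_split; apply: eq_bigr => u _ /=.
rewrite scaler_sumr -big_split; apply: eq_bigr => w1 _ /=.
rewrite scaler_sumr -big_split; apply: eq_bigr => w2 _ /=.
by rewrite !ffunE scalerA -scalerDl.
Qed.

(** In the basis indexed by factorizations, psi is the tensor product with the
    identity on the multiplicity space; the remaining properties of psi are
    consequences of this formula. *)
Lemma edge_psiE (a : edge_alg K n) (b : edge_alg K m) w1 w2 (u : 'S_(n + m)) :
  block_increasing u ->
  edge_app (edge_psi a b) (ev (par w1 w2 * u)%g) =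
  edge_glue (edge_app a (ev w1)) (edge_app b (ev w2)) u.
Proof.
move=> ui; rewrite /edge_psi /edge_app (linfun_linearE (edge_psi_linear a b)) -/(edge_app _).
have zero v1 v2 (v : 'S_(n + m)) : block_increasing v -> ~ [/\ v1 = w1, v2 = w2 & v = u] ->
    ev (par w1 w2 * u)%g (par v1 v2 * v)%g = 0.
  by move=> vi nv; rewrite edgevE; case: eqP => // /(par_factor_uniq vi ui).
rewrite (bigD1 u) /=; last exact/min_coset_repP.
rewrite [X in _ + X]big1 ?addr0 => [|v /andP[/min_coset_repP vi /eqP nv]]; last first.
  by apply: big1 => v1 _; apply: big1 => v2 _; rewrite zero ?scale0r // => -[].
rewrite (bigD1 w1) //= [X in _ + X]big1 ?addr0 => [|v1 /eqP nv]; last first.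
  by apply: big1 => v2 _; rewrite zero ?scale0r // => -[].
rewrite (bigD1 w2) //= [X in _ + X]big1 ?addr0 => [|v2 /eqP nv]; last first.
  by rewrite zero ?scale0r // => -[].
by rewrite edgevE eqxx scale1r.
Qed.

Lemma block_ext (a b : edge_alg K (n + m)) :
  (forall w1 w2 u, block_increasing u ->
     edge_app a (ev (par w1 w2 * u)%g) = edge_app b (ev (par w1 w2 * u)%g)) -> a = b.
Proof.
by move=> ab; apply: edge_ext => w; have [w1 [w2 [u [ui ->]]]] := par_factor w; apply: ab.
Qed.

Lemma edge_psi_glue (a : edge_alg K n) (b : edge_alg K m) x y (u : 'S_(n + m)) :
  block_increasing u ->
  edge_app (edge_psi a b) (edge_glue x y u) = edge_glue (edge_app a x) (edge_app b y) u.
Proof.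
move=> ui; rewrite (edge_app_expand a x) (edge_app_expand b y).
rewrite [RHS](_ : _ = \sum_w1 \sum_w2 (x w1 * y w2) *:
  edge_glue (edge_app a (ev w1)) (edge_app b (ev w2)) u); last exact: edge_glue_expand.
rewrite /edge_glue linear_sum; apply: eq_bigr => w1 _.
rewrite linear_sum; apply: eq_bigr => w2 _.
by rewrite linearZ /= edge_psiE.
Qed.

Lemma edge_psi1 : edge_psi 1 1 = 1 :> edge_alg K (n + m).
Proof.
by apply: block_ext => w1 w2 u ui; rewrite edge_psiE // !edge_1E edge_glue_edgev.
Qed.

Lemma edge_psiM (a a' : edge_alg K n) (b b' : edge_alg K m) :
  edge_psi (a * a') (b * b') = edge_psi a b * edge_psi a' b'.
Proof.
apply: block_ext => w1 w2 u ui.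
by rewrite edge_mulE !edge_psiE // edge_psi_glue // !edge_mulE.
Qed.

Lemma edge_psi_linl c (a a' : edge_alg K n) (b : edge_alg K m) :
  edge_psi (c *: a + a') b = c *: edge_psi a b + edge_psi a' b.
Proof.
apply: block_ext => w1 w2 u ui.
by rewrite edge_linE !edge_psiE // edge_linE edge_glue_linl.
Qed.

Lemma edge_psi_linr c (a : edge_alg K n) (b b' : edge_alg K m) :
  edge_psi a (c *: b + b') = c *: edge_psi a b + edge_psi a b'.
Proof.
apply: block_ext => w1 w2 u ui.
by rewrite edge_linE !edge_psiE // edge_linE edge_glue_linr.
Qed.

End EdgePsi.

Lemma edge_degP (K : fieldType) n d (a : edge_alg K n) :
  end_deg (@edgeW_comp K n) d a <->
  forall w v, edge_app a (edgev K w) v != 0 -> edge_wt v = edge_wt w + d.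
Proof.
split=> [da w v|da e].
  apply: edgeW_compP; apply: (subvP (da (edge_wt w))); apply: memv_img.
  by apply: memv_span; apply: image_f; rewrite inE.
rewrite limg_span; apply/span_subvP => _ /mapP[_ /imageP[w /eqP we ->] ->].
by apply/edgeW_compP => v /da ->; rewrite we.
Qed.

Section EdgePsiMore.
Variables (K : fieldType) (n m : nat).
Local Notation ev := (edgev K).

Lemma edge_psi_deg d e (a : edge_alg K n) (b : edge_alg K m) :
  end_deg (@edgeW_comp K n) d a -> end_deg (@edgeW_comp K m) e b ->
  end_deg (@edgeW_comp K (n + m)) (d + e) (edge_psi a b).
Proof.
move=> /edge_degP da /edge_degP eb; apply/edge_degP => w v.
have [w1 [w2 [u [ui ->]]]] := par_factor w; have [v1 [v2 [u' [ui' ->]]]] := par_factor v.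
rewrite edge_psiE // edge_glueE //; case: (u' =P u) => [->|_]; last by rewrite eqxx.
rewrite mulf_eq0 negb_or => /andP[/da + /eb].
by rewrite /edge_wt !coxlen_par_mul // !PoszD; lia.
Qed.

Lemma edge_psi_morphism : psi_morphism (edge_cat K) n m.
Proof.
split=> /=.
- exact: edge_psi_linl.
- exact: edge_psi_linr.
- exact: edge_psi1.
- exact: edge_psiM.
- exact: edge_psi_deg.
Qed.

Lemma edge_psiZl c (a : edge_alg K n) (b : edge_alg K m) :
  edge_psi (c *: a) b = c *: edge_psi a b.
Proof. exact: (linear_funZ (fun c a a' => edge_psi_linl c a a' b)). Qed.
Lemma edge_psiZr c (a : edge_alg K n) (b : edge_alg K m) :
  edge_psi a (c *: b) = c *: edge_psi a b.
Proof. exact: (linear_funZ (fun c b b' => edge_psi_linr c a b b')). Qed.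

Lemma srefl_shl_par i w1 w2 (u : 'S_(n + m)) :
  (srefl (shl m i) * (par w1 w2 * u) = par (srefl i * w1) w2 * u)%g.
Proof. by rewrite -par_srefl_l mulgA parM mul1g. Qed.
Lemma srefl_shr_par i w1 w2 (u : 'S_(n + m)) :
  (srefl (shr n i) * (par w1 w2 * u) = par w1 (srefl i * w2) * u)%g.
Proof. by rewrite -par_srefl_r mulgA parM mul1g. Qed.

Lemma asc_par_l i w1 w2 (u : 'S_(n + m)) : block_increasing u ->
  ((par w1 w2 * u)%g (pos_l (shl m i)) < (par w1 w2 * u)%g (pos_r (shl m i)))%N =
  (w1 (pos_l i) < w1 (pos_r i))%N.
Proof. by case=> ul _; rewrite pos_l_shl pos_r_shl !permM !par_l (increasing_ltn ul). Qed.
Lemma asc_par_r i w1 w2 (u : 'S_(n + m)) : block_increasing u ->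
  ((par w1 w2 * u)%g (pos_l (shr n i)) < (par w1 w2 * u)%g (pos_r (shr n i)))%N =
  (w2 (pos_l i) < w2 (pos_r i))%N.
Proof. by case=> _ ur; rewrite pos_l_shr pos_r_shr !permM !par_r (increasing_ltn ur). Qed.

Let glue0l (y : edgeW K m) (u : 'S_(n + m)) : edge_glue 0 y u = 0.
Proof.
by rewrite /edge_glue big1 // => w1 _; rewrite big1 // => w2 _; rewrite ffunE mul0r scale0r.
Qed.
Let glue0r (x : edgeW K n) (u : 'S_(n + m)) : edge_glue x 0 u = 0.
Proof.
by rewrite /edge_glue big1 // => w1 _; rewrite big1 // => w2 _; rewrite ffunE mulr0 scale0r.
Qed.

(** An ascent inside a block is seen by the block alone, and acting there keeps
    the coset representative. *)
Lemma edge_psi_d_l (i : 'I_n.-1) :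
  edge_psi (edge_d K i) (1 : edge_alg K m) = edge_d K (shl m i).
Proof.
apply: block_ext => w1 w2 u ui; rewrite edge_psiE // edge_1E !edge_dE asc_par_l //.
by case: ifP => _; rewrite ?glue0l // edge_glue_edgev srefl_shl_par.
Qed.
Lemma edge_psi_d_r (i : 'I_m.-1) :
  edge_psi (1 : edge_alg K n) (edge_d K i) = edge_d K (shr n i).
Proof.
apply: block_ext => w1 w2 u ui; rewrite edge_psiE // edge_1E !edge_dE asc_par_r //.
by case: ifP => _; rewrite ?glue0r // edge_glue_edgev srefl_shr_par.
Qed.
Lemma edge_psi_dm_l (i : 'I_n.-1) :
  edge_psi (edge_dm K i) (1 : edge_alg K m) = edge_dm K (shl m i).
Proof.
apply: block_ext => w1 w2 u ui.
rewrite edge_psiE // edge_1E !edge_dmE asc_or_desc asc_or_desc asc_par_l //.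
by case: ifP => _; rewrite ?glue0l // edge_glue_edgev srefl_shl_par.
Qed.
Lemma edge_psi_dm_r (i : 'I_m.-1) :
  edge_psi (1 : edge_alg K n) (edge_dm K i) = edge_dm K (shr n i).
Proof.
apply: block_ext => w1 w2 u ui.
rewrite edge_psiE // edge_1E !edge_dmE asc_or_desc asc_or_desc asc_par_r //.
by case: ifP => _; rewrite ?glue0r // edge_glue_edgev srefl_shr_par.
Qed.

End EdgePsiMore.


(** * Associativity and units *)

Section GlueBasis.
Variables (K : fieldType) (n m : nat).
Local Notation ev := (edgev K).

Lemma edge_glue_evl v (y : edgeW K m) (u : 'S_(n + m)) :
  edge_glue (ev v) y u = \sum_w y w *: ev (par v w * u)%g.
Proof.
rewrite /edge_glue (bigD1 v) //= [X in _ + X]big1 ?addr0 => [|v1 nv1]; last first.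
  by apply: big1 => w _; rewrite edgevE (negPf nv1) mul0r scale0r.
by apply: eq_bigr => w _; rewrite edgevE eqxx mul1r.
Qed.

Lemma edge_glue_suml (x : edgeW K n) (y : edgeW K m) (u : 'S_(n + m)) :
  edge_glue x y u = \sum_w x w *: edge_glue (ev w) y u.
Proof.
apply: eq_bigr => w _; rewrite edge_glue_evl scaler_sumr.
by apply: eq_bigr => v _; rewrite scalerA.
Qed.

End GlueBasis.

Section Cast.
Variable K : fieldType.
Local Notation ev := (edgev K).

(** Transport along an equality of strand numbers, which the associativity and
    unit laws need because [addnA] and [addn0] are not definitional. *)
Definition edgeW_cast n n' (e : n = n') (x : edgeW K n) : edgeW K n' :=
  ecast k (edgeW K k) e x.

Lemma edgeW_cast_edgev n n' (e : n = n') w : edgeW_cast e (ev w) = ev (cast_perm e w).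
Proof. by case: _ / e; rewrite cast_perm_id. Qed.

Lemma edgeW_cast_linear n n' (e : n = n') : linear (edgeW_cast e).
Proof. by case: _ / e. Qed.

Lemma edge_app_cast n n' (e : n = n') (a : edge_alg K n) x :
  edge_app (ecast k (edge_alg K k) e a) (edgeW_cast e x) = edgeW_cast e (edge_app a x).
Proof. by case: _ / e. Qed.

End Cast.

Section Assoc.
Variables n m r : nat.
Local Notation e := (addnA n m r).

Lemma cast_block1 (i : 'I_n) :
  cast_ord (esym e) (lshift r (lshift m i)) = lshift (m + r) i.
Proof. exact: val_inj. Qed.
Lemma cast_block2 (i : 'I_m) :
  cast_ord (esym e) (lshift r (rshift n i)) = rshift n (lshift r i).
Proof. exact: val_inj. Qed.
Lemma cast_block3 (i : 'I_r) :
  cast_ord (esym e) (rshift (n + m) i) = rshift n (rshift m i).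
Proof. by apply: val_inj; rewrite /= addnA. Qed.

Lemma cast_par (w1 : 'S_n) (w2 : 'S_m) (w3 : 'S_r) :
  cast_perm e (par w1 (par w2 w3)) = par (par w1 w2) w3.
Proof.
apply: perm_splitP => x; last first.
  by rewrite cast_permE cast_block3 !par_r -cast_block3 cast_ordKV.
rewrite [RHS]par_l; case: (split_ordP x) => i ->; rewrite cast_permE.
  by rewrite cast_block1 !par_l -cast_block1 cast_ordKV.
by rewrite cast_block2 par_r !par_l par_r -cast_block2 cast_ordKV.
Qed.

(** The permutation [T] increases on three consecutive blocks.  Factoring it for
    the other bracketing, the factors in [S_n], [S_m], [S_r] increase, hence are
    trivial, and what is left are the two representatives. *)
Lemma assoc_rep (u : 'S_(n + m)) (u' : 'S_(n + m + r)) :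
  block_increasing u -> block_increasing u' ->
  exists (U : 'S_(m + r)) (U' : 'S_(n + (m + r))),
  [/\ block_increasing U, block_increasing U' &
      forall w1 w2 w3, (par (par w1 w2 * u) w3 * u' =
        cast_perm e (par w1 (par w2 w3 * U) * U'))%g].
Proof.
move=> [ul ur] [ul' ur'].
pose T := (par u 1 * u')%g; pose V := cast_perm (esym e) T.
have VE x : V x = cast_ord (esym e) (T (cast_ord e x)).
  by rewrite cast_permE esymK.
have V1 : {homo (fun i => V (lshift (m + r) i)) : x y / (x < y)%N}.
  move=> x y xy; rewrite !VE /= -!cast_block1 !cast_ordKV !permM !par_l.
  exact/ul'/ul.
have V2 : {homo (fun i => V (rshift n (lshift r i))) : x y / (x < y)%N}.
  move=> x y xy; rewrite !VE /= -!cast_block2 !cast_ordKV !permM !par_l.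
  exact/ul'/ur.
have V3 : {homo (fun i => V (rshift n (rshift m i))) : x y / (x < y)%N}.
  move=> x y xy; rewrite !VE /= -!cast_block3 !cast_ordKV !permM !par_r !perm1.
  exact: ur'.
have [v1 [W [U' [iU' eV]]]] := par_factor V.
have [v2 [v3 [U [iU eW]]]] := par_factor W.
have [Ul Ur] := iU; have [Ul' Ur'] := iU'.
have e1 : v1 = 1%g.
  apply: increasing_perm => x y /V1.
  by rewrite eV !permM !par_l (increasing_ltn Ul').
have e2 : v2 = 1%g.
  apply: increasing_perm => x y /V2.
  by rewrite eV eW !permM !par_r (increasing_ltn Ur') !permM !par_l (increasing_ltn Ul).
have e3 : v3 = 1%g.
  apply: increasing_perm => x y /V3.
  by rewrite eV eW !permM !par_r (increasing_ltn Ur') !permM !par_r (increasing_ltn Ur).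
exists U, U'; split=> // w1 w2 w3.
have -> : (par w1 (par w2 w3 * U) * U' = par w1 (par w2 w3) * V)%g.
  by rewrite eV eW e1 e2 e3 par1 mul1g mulgA parM mulg1.
by rewrite cast_perm_morphM cast_par cast_permKV mulgA parM mulg1.
Qed.

Variable K : fieldType.
Local Notation ev := (edgev K).

(** Both sides expand as sums over triples of indices, one for each block, of the
    same coefficients; [assoc_rep] identifies the basis vectors. *)
Lemma edge_psiA (a : edge_alg K n) (b : edge_alg K m) (c : edge_alg K r) :
  edge_psi (edge_psi a b) c =
  ecast k (edge_alg K k) e (edge_psi a (edge_psi b c)).
Proof.
apply: block_ext => w w3 u' iu'; have [w1 [w2 [u [iu ->]]]] := par_factor w.
have [U [U' [iU iU' eU]]] := assoc_rep iu iu'.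
rewrite edge_psiE // edge_psiE // eU -edgeW_cast_edgev edge_app_cast edge_psiE // edge_psiE //.
set x := edge_app a _; set y := edge_app b _; set z := edge_app c _.
transitivity (\sum_v1 \sum_v2 \sum_v3
    (x v1 * y v2 * z v3) *: ev (par (par v1 v2 * u) v3 * u')%g).
  rewrite {1}[edge_glue x y u]/edge_glue (linear_fun_sum (edge_glue_linl _ u')).
  apply: eq_bigr => v1 _; rewrite (linear_fun_sum (edge_glue_linl _ u')).
  apply: eq_bigr => v2 _; rewrite (linear_funZ (edge_glue_linl _ u')).
  rewrite edge_glue_evl scaler_sumr.
  by apply: eq_bigr => v3 _; rewrite scalerA.
rewrite edge_glue_suml (linear_fun_sum (edgeW_cast_linear e)).
apply: eq_bigr => v1 _; rewrite (linear_funZ (edgeW_cast_linear e)).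
rewrite {1}[edge_glue y z U]/edge_glue (linear_fun_sum (edge_glue_linr _ U')).
rewrite (linear_fun_sum (edgeW_cast_linear e)) scaler_sumr; apply: eq_bigr => v2 _.
rewrite (linear_fun_sum (edge_glue_linr _ U')).
rewrite (linear_fun_sum (edgeW_cast_linear e)) scaler_sumr; apply: eq_bigr => v3 _.
rewrite (linear_funZ (edge_glue_linr _ U')) (linear_funZ (edgeW_cast_linear e)) scalerA.
by rewrite edge_glue_edgev edgeW_cast_edgev -eU mulrA.
Qed.

End Assoc.

Section Unit.
Variables (K : fieldType) (n : nat).
Local Notation ev := (edgev K).

Lemma perm0_eq1 (w : 'S_0) : w = 1%g.
Proof. by apply/permP => -[]. Qed.

Lemma par0l (w0 : 'S_0) (w : 'S_n) : par w0 w = w :> 'S_(0 + n).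
Proof.
have shift0 (j : 'I_n) : rshift 0 j = j by apply: val_inj.
by apply: perm_splitP => [[]//|] i; rewrite par_r !shift0.
Qed.

Lemma par0r (w : 'S_n) (w0 : 'S_0) : par w w0 = cast_perm (esym (addn0 n)) w.
Proof.
apply: perm_splitP => [|[]//] i; rewrite par_l cast_permE.
by apply: val_inj => /=; congr (val (w _)); apply: val_inj.
Qed.

Lemma edge_psi_1l (a : edge_alg K n) : edge_psi (1 : edge_alg K 0) a = a.
Proof.
apply: edge_ext => w; have i1 := block_increasing1 0 n.
rewrite -{1}[w]mulg1 -{1}(par0l 1 w) edge_psiE // edge_1E /edge_glue.
rewrite (big_pred1 1%g) => [|v]; last by rewrite /= (perm0_eq1 v) eqxx.
rewrite [RHS]edge_expand; apply: eq_bigr => w' _.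
by rewrite par0l mulg1 [ev _ _]edgevE eqxx mul1r.
Qed.

Lemma edge_psi_1r (a : edge_alg K n) :
  edge_psi a (1 : edge_alg K 0) = ecast k (edge_alg K k) (esym (addn0 n)) a.
Proof.
apply: edge_ext => w; have i1 := block_increasing1 n 0.
rewrite -(cast_permKV (esym (addn0 n)) w) -edgeW_cast_edgev edge_app_cast edgeW_cast_edgev.
set w' := cast_perm (esym _) w; rewrite -(par0r w' 1) -[par _ _]mulg1 edge_psiE //.
rewrite edge_1E edge_glue_suml [in RHS](edge_expand (edge_app a _)).
rewrite (linear_fun_sum (edgeW_cast_linear _)); apply: eq_bigr => v _.
by rewrite (linear_funZ (edgeW_cast_linear _)) edgeW_cast_edgev edge_glue_edgev mulg1 par0r.
Qed.
End Unit.

Lemma edge_cat_gmc K : graded_minimal_categorification (edge_cat K).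
Proof.
split=> /=.
- move=> n; exists (edgeW K n), (@edgeW_comp K n), (edge_degs n); split.
  + exact: edge_grading.
  + by rewrite edge_graded_dim sum_qvar_wt.
  by exists id; split=> //; exists id.
- move=> a; exists (edge_app a (edgev K 1%g) 1%g); apply: edge_ext => w.
  rewrite (perm0_eq1 w) edge_scaleE edge_1E [LHS]edge_expand.
  by rewrite (big_pred1 1%g) => [//|v]; rewrite /= (perm0_eq1 v) eqxx.
- exact: edge_psi_morphism.
- by move=> n m r a b c; apply: edge_psiA.
by move=> n a; split; [exact: edge_psi_1l|exact: edge_psi_1r].
Qed.


(** * Homogeneous operators *)

Section EdgeDegrees.
Variables (K : fieldType) (n : nat).
Local Notation deg := (end_deg (@edgeW_comp K n)).

Lemma edge_deg_mul d e (a b : edge_alg K n) : deg d a -> deg e b -> deg (d + e) (a * b).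
Proof.
move=> da eb k; rewrite [X in lfun_img X]/(a * b)%R limg_comp addrCA addrC.
by apply: subv_trans (da _); apply: limgS; apply: eb.
Qed.

Lemma edge_d_deg (i : 'I_n.-1) : deg (-2) (edge_d K i).
Proof.
apply/edge_degP => w v; rewrite edge_dE; case: ifP => [asc|_]; last by rewrite ffunE eqxx.
rewrite edgevE; case: (v =P _) => [->|_]; last by rewrite eqxx.
by rewrite /edge_wt coxlen_srefl asc; lia.
Qed.

Lemma edge_dm_deg (i : 'I_n.-1) : deg 2 (edge_dm K i).
Proof.
apply/edge_degP => w v; rewrite edge_dmE; case: ifP => [desc|_]; last by rewrite ffunE eqxx.
rewrite edgevE; case: (v =P _) => [->|_]; last by rewrite eqxx.
by rewrite /edge_wt !coxlenE (inversions_desc desc); lia.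
Qed.

Lemma edge_unit_deg w v : deg (edge_wt w - edge_wt v) (edge_unit K w v).
Proof.
apply/edge_degP => w' v'; rewrite edge_unitE; case: (w' =P _) => [->|_]; last by rewrite ffunE eqxx.
by rewrite edgevE; case: (v' =P _) => [->|_]; [lia|rewrite eqxx].
Qed.

End EdgeDegrees.

Section TwoStrands.
Variable K : fieldType.
Local Notation i0 := (ord0 : 'I_2.-1).
Local Notation ev := (@edgev K 2).

Lemma perm2P (w : 'S_2) : w = 1%g \/ w = srefl i0.
Proof.
have id2 (v : 'S_2) : (v (pos_l i0) < v (pos_r i0))%N -> v = 1%g.
  by move=> asc; apply: no_descent => i; rewrite (ord1 i).
have [/id2|] := boolP (w (pos_l i0) < w (pos_r i0))%N; first by left.
rewrite -asc_or_desc => desc; right.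
rewrite -[w](sreflK i0) (id2 (srefl i0 * w)%g) ?mulg1 //.
by rewrite !permM srefl_l srefl_r.
Qed.

Lemma wt2_1 : edge_wt (1 : 'S_2)%g = 1.
Proof. by rewrite /edge_wt coxlenE inversions1. Qed.
Lemma wt2_s : edge_wt (srefl i0) = -1.
Proof. by rewrite /edge_wt -[srefl _]mulg1 coxlen_srefl !perm1 coxlenE inversions1. Qed.

(** The degrees of [W_2] are 1 and -1, so an operator of degree -2 has a single
    matrix coefficient that can be nonzero. *)
Lemma edge2_deg (a : edge_alg K 2) : end_deg (@edgeW_comp K 2) (-2) a ->
  exists t, a = t *: edge_d K i0.
Proof.
move=> /edge_degP da; exists (edge_app a (ev 1%g) (srefl i0)); apply: edge_ext => w.
rewrite edge_scaleE edge_dE; apply/ffunP => v; rewrite ffunE.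
have zero v' w' : edge_wt v' <> edge_wt w' - 2 -> edge_app a (ev w') v' = 0.
  by move=> nwt; apply/eqP; apply: contraT => /da.
have [->|->] := perm2P w; last first.
  rewrite srefl_l srefl_r ffunE; rewrite zero ?scaler0 //.
  by rewrite wt2_s; have [->|->] := perm2P v; rewrite ?wt2_1 ?wt2_s.
rewrite !perm1 /= mulg1 edgevE; have [->|->] := perm2P v; last first.
  by rewrite eqxx /GRing.scale /= mulr1.
rewrite zero ?wt2_1 // (_ : (1%g == _) = false) ?scaler0 //.
by apply/eqP => e; have := wt2_s; rewrite -e wt2_1.
Qed.

Lemma edge2_degm (a : edge_alg K 2) : end_deg (@edgeW_comp K 2) 2 a ->
  exists t, a = t *: edge_dm K i0.
Proof.
move=> /edge_degP da; exists (edge_app a (ev (srefl i0)) 1%g); apply: edge_ext => w.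
rewrite edge_scaleE edge_dmE; apply/ffunP => v; rewrite ffunE.
have zero v' w' : edge_wt v' <> edge_wt w' + 2 -> edge_app a (ev w') v' = 0.
  by move=> nwt; apply/eqP; apply: contraT => /da.
have [->|->] := perm2P w.
  rewrite !perm1 ffunE zero ?scaler0 //.
  by rewrite wt2_1; have [->|->] := perm2P v; rewrite ?wt2_1 ?wt2_s.
rewrite srefl_l srefl_r /= (_ : (srefl i0 * srefl i0)%g = 1%g) ?edgevE; last exact: tperm2.
have [->|->] := perm2P v; first by rewrite eqxx /GRing.scale /= mulr1.
rewrite zero ?wt2_s // (_ : (_ == 1%g) = false) ?scaler0 //.
by apply/eqP => e; have := wt2_s; rewrite e wt2_1.
Qed.

End TwoStrands.


(** * The action on three strands *)

Section Steps.
Variables (K : fieldType) (n : nat) (i : 'I_n.-1) (w v : 'S_n).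

Lemma edge_d_asc : (w (pos_l i) < w (pos_r i))%N = true -> (srefl i * w)%g = v ->
  edge_app (edge_d K i) (edgev K w) = edgev K v.
Proof. by move=> asc <-; rewrite edge_dE asc. Qed.

Lemma edge_dm_desc : (w (pos_l i) < w (pos_r i))%N = false -> (srefl i * w)%g = v ->
  edge_app (edge_dm K i) (edgev K w) = edgev K v.
Proof. by move=> desc <-; rewrite edge_dmE asc_or_desc desc. Qed.

Lemma edge_dm_asc : (w (pos_l i) < w (pos_r i))%N = true ->
  edge_app (edge_dm K i) (edgev K w) = 0.
Proof. by move=> asc; rewrite edge_dmE asc_or_desc asc. Qed.
End Steps.

Section ThreeStrands.
Variable K : fieldType.
Notation s1 := (shl 1 (ord0 : 'I_2.-1)).
Notation s2 := (shr 1 (ord0 : 'I_2.-1)).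
Notation ev := (@edgev K 3).

Definition w_1 : 'S_3 := srefl s1.
Definition w_2 : 'S_3 := srefl s2.
Definition w_12 : 'S_3 := (srefl s1 * srefl s2)%g.
Definition w_21 : 'S_3 := (srefl s2 * srefl s1)%g.
(** The longest element of [S_3]. *)
Definition w_121 : 'S_3 := (srefl s1 * w_21)%g.

Lemma braid3 : w_121 = (srefl s2 * w_12)%g.
Proof.
apply/permP => -[[|[|[|//]]] lt]; apply: val_inj;
by rewrite /w_121 /w_21 /w_12 !permM /srefl !permE /=.
Qed.

Definition ascents3 (w : 'S_3) := ((w (pos_l s1) < w (pos_r s1))%N, (w (pos_l s2) < w (pos_r s2))%N).

Lemma ascents3_table :
  [/\ ascents3 1 = (true, true), ascents3 w_1 = (false, true), ascents3 w_2 = (true, false) &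
   [/\ ascents3 w_12 = (false, true), ascents3 w_21 = (true, false) & ascents3 w_121 = (false, false)]]%g.
Proof.
rewrite /ascents3 /w_121 /w_21 /w_12 /w_1 /w_2; split; [| | |split];
 rewrite ?perm1 ?permM /srefl ?permE //=.
Qed.

Notation d1 := (edge_d K s1).
Notation d2 := (edge_d K s2).
Notation dm1 := (edge_dm K s1).
Notation dm2 := (edge_dm K s2).

Lemma srefl2_w_121 : (srefl s2 * w_121)%g = w_12. Proof. by rewrite braid3 sreflK. Qed.
Lemma srefl1_w_121 : (srefl s1 * w_121)%g = w_21. Proof. exact: sreflK. Qed.

Lemma d_table :
  [/\ edge_app d1 (ev 1%g) = ev w_1, edge_app d2 (ev 1%g) = ev w_2,
      edge_app d1 (ev w_2) = ev w_12, edge_app d2 (ev w_1) = ev w_21 &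
      edge_app d1 (ev w_21) = ev w_121 /\ edge_app d2 (ev w_12) = ev w_121].
Proof.
have [[a1 a2] [b1 b2] [c1 c2] [[e1 e2] [f1 f2] [g1 g2]]] := ascents3_table.
split; [| | | |split].
- exact: edge_d_asc a1 (mulg1 _).
- exact: edge_d_asc a2 (mulg1 _).
- exact: edge_d_asc c1 (erefl _).
- exact: edge_d_asc b2 (erefl _).
- exact: edge_d_asc f1 (erefl _).
exact: edge_d_asc e2 (esym braid3).
Qed.

Lemma dm_table :
  [/\ [/\ edge_app dm1 (ev w_121) = ev w_21, edge_app dm1 (ev w_12) = ev w_2 &
         edge_app dm1 (ev w_21) = 0],
      [/\ edge_app dm1 (ev w_1) = ev 1%g, edge_app dm1 (ev w_2) = 0 &
         edge_app dm1 (ev 1%g) = 0],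
      [/\ edge_app dm2 (ev w_121) = ev w_12, edge_app dm2 (ev w_12) = 0 &
         edge_app dm2 (ev w_21) = ev w_1] &
      [/\ edge_app dm2 (ev w_1) = 0, edge_app dm2 (ev w_2) = ev 1%g &
         edge_app dm2 (ev 1%g) = 0]].
Proof.
have [[a1 a2] [b1 b2] [c1 c2] [[e1 e2] [f1 f2] [g1 g2]]] := ascents3_table.
split; split.
- exact: edge_dm_desc g1 srefl1_w_121.
- exact: edge_dm_desc e1 (sreflK _ _).
- exact: edge_dm_asc f1.
- exact: edge_dm_desc b1 (tperm2 _ _).
- exact: edge_dm_asc c1.
- exact: edge_dm_asc a1.
- exact: edge_dm_desc g2 srefl2_w_121.
- exact: edge_dm_asc e2.
- exact: edge_dm_desc f2 (sreflK _ _).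
- exact: edge_dm_asc b2.
- exact: edge_dm_desc c2 (tperm2 _ _).
exact: edge_dm_asc a2.
Qed.

Lemma le3_coxlen (w : 'S_3) : (coxlen w <= 3)%N.
Proof.
rewrite coxlenE; apply: (@leq_trans (\sum_(x < 3) \sum_(y < 3) (x < y))%N).
  by apply: leq_sum => x _; apply: leq_sum => y _; case: (_ < _)%N; case: (_ < _)%N.
by rewrite !big_ord_recl !big_ord0.
Qed.

Lemma wt3 (w : 'S_3) : edge_wt w = 3 - 2 * (coxlen w)%:Z.
Proof. by []. Qed.

Lemma coxlen_w_121 : coxlen w_121 = 3%N.
Proof.
have [[a1 a2] [b1 b2] [c1 c2] [[e1 e2] [f1 f2] [g1 g2]]] := ascents3_table.
have step (w : 'S_3) i : (w (pos_l i) < w (pos_r i))%N = true ->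
    coxlen (srefl i * w)%g = (coxlen w).+1 by move=> asc; rewrite coxlen_srefl asc.
rewrite (step w_21 _ f1) (step w_1 _ b2); congr _.+2.
by rewrite -[w_1]mulg1 (step _ _ a1) coxlenE inversions1.
Qed.

Lemma deg6_ext (a b : edge_alg K 3) :
  end_deg (@edgeW_comp K 3) (-6) a -> end_deg (@edgeW_comp K 3) (-6) b ->
  edge_app a (ev 1%g) = edge_app b (ev 1%g) -> a = b.
Proof.
have zero (c : edge_alg K 3) w : end_deg (@edgeW_comp K 3) (-6) c -> w != 1%g ->
    edge_app c (ev w) = 0.
  move=> /edge_degP dc; rewrite -coxlen_eq0 => w1; apply/ffunP => v; rewrite ffunE.
  apply/eqP; apply: contraT => /dc; rewrite !wt3; have := le3_coxlen v; lia.
move=> da db ab; apply: edge_ext => w; have [->//|w1] := eqVneq w 1%g.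
by rewrite !zero.
Qed.

(** Operators of degree -6 are determined by their value on [v_id], the lengths
    being at most 3. *)
Lemma braid_d : d2 * d1 * d2 = d1 * d2 * d1.
Proof.
have deg6 (i j k : 'I_3.-1) :
    end_deg (@edgeW_comp K 3) (-6) (edge_d K i * edge_d K j * edge_d K k).
  have -> : (-6 : int)%R = (-2 + -2 + -2)%R by [].
  apply: edge_deg_mul; last exact: edge_d_deg.
  by apply: edge_deg_mul; apply: edge_d_deg.
have word (a b c : edge_alg K 3) x y z t : edge_app c x = y -> edge_app b y = z ->
    edge_app a z = t -> edge_app (a * b * c) x = t.
  by move=> cx cy cz; rewrite edge_mulE cx edge_mulE cy.
have [e1 e2 e12 e21 [e121 e212]] := d_table.
apply: deg6_ext; [exact: deg6|exact: deg6|].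
exact: etrans (word _ _ _ _ _ _ _ e2 e12 e212) (esym (word _ _ _ _ _ _ _ e1 e21 e121)).
Qed.

End ThreeStrands.


Section StandardThreeStrands.
Variable K : fieldType.
Local Notation i0 := (ord0 : 'I_2.-1).

Lemma edge_end_iso n : end_iso (C := edge_cat K) (@edgeW_comp K n) id.
Proof. by split=> //; exists id. Qed.

Lemma edge_top_degree : edgeW_comp K 3 3 = <[edgev K (1 : 'S_3)%g]>%VS.
Proof.
apply/eqP; rewrite eqEsubv -memvE; apply/andP; split; last first.
  apply/edgeW_compP => w; rewrite edgevE; case: (w =P 1%g) => [-> _|_].
    by rewrite wt3 coxlenE inversions1.
  by rewrite eqxx.
apply/subvP => x /edgeW_compP xd; apply/vlineP; exists (x 1%g).
apply/ffunP => w; rewrite ffunE edgevE.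
have [->|w1] := eqVneq w 1%g; first by rewrite /GRing.scale /= mulr1.
rewrite scaler0; apply/eqP; apply: contraT => /xd; rewrite wt3.
by move: w1; rewrite -coxlen_eq0; lia.
Qed.

Definition edge_three_strands : three_strands (edge_cat K) :=
  @ThreeStrands K (edge_cat K) (edge_d K i0) (edge_dm K i0)
    (edgeW K 3) (@edgeW_comp K 3) (edge_degs 3) id (edgev K 1%g)
    (edge_d_deg K i0) (edge_dm_deg K i0) (edge_d_sq K i0) (edge_dm_sq K i0) (edge_ddm K i0)
    (edge_grading K 3) (etrans (edge_graded_dim K 3) (sum_qvar_wt 3))
    (edge_end_iso 3) (edgev_neq0 K 1%g) edge_top_degree.

End StandardThreeStrands.

(** * Comparing W_3 with the edge space *)

(** Multiplied by a large power of [q], a Laurent polynomial becomes a polynomial,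
    whose coefficients can be compared in the fraction field. *)
Lemma laurent_coef (N : nat) (s : seq int) (c : int -> nat) (d : int) :
  uniq s -> (forall e, e \notin s -> c e = 0%N) ->
  (forall e, e \in d :: s -> 0 <= N%:Z + e) ->
  exists2 p : {poly rat}, qvar ^+ N * (\sum_(e <- s) (c e)%:R * qvar ^ e) = tofrac p &
    p`_(absz (N%:Z + d)) = (c d)%:R.
Proof.
move=> s_uniq c0 sN; exists (\sum_(e <- s) (c e)%:R * 'X^(absz (N%:Z + e))).
  rewrite rmorph_sum mulr_sumr big_seq [RHS]big_seq; apply: eq_bigr => e es.
  rewrite rmorphM rmorph_nat mulrCA; congr (_ * _).
  rewrite -[qvar ^+ N]/(qvar ^ N%:Z) -expfzDr ?qvar_neq0 //.
  by rewrite rmorphXn -{1}[N%:Z + e]gez0_abs // sN // inE es orbT.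
rewrite coef_sum.
have coefE (e : int) : e \in s ->
    ((c e)%:R * 'X^(absz (N%:Z + e)) : {poly rat})`_(absz (N%:Z + d)) =
    if e == d then (c d)%:R else 0.
  move=> es; rewrite mulr_natl coefMn coefXn.
  have -> : (absz (N%:Z + d) == absz (N%:Z + e)) = (e == d).
    have := sN e; have := sN d; rewrite !inE eqxx es orbT /= => /(_ isT) + /(_ isT); lia.
  by case: eqP => [->|_]; rewrite ?mul0rn.
rewrite big_seq (eq_bigr _ coefE) -big_seq.
have [ds|nds] := boolP (d \in s).
  by rewrite (bigD1_seq d) //= eqxx big1 ?addr0 // => e /negPf ->.
rewrite (c0 d nds) big_seq big1 // => e es.
by case: eqP => // ed; rewrite ed (negPf nds) in es.
Qed.

Lemma laurent_uniq (s s' : seq int) (c c' : int -> nat) : uniq s -> uniq s' ->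
  (forall e, e \notin s -> c e = 0%N) -> (forall e, e \notin s' -> c' e = 0%N) ->
  \sum_(e <- s) (c e)%:R * qvar ^ e = \sum_(e <- s') (c' e)%:R * qvar ^ e -> c =1 c'.
Proof.
move=> us us' c0 c0' cc' d.
(* any [N] bounding the absolute values of the exponents will do *)
pose N := (\sum_(e <- d :: s ++ s') absz e)%N.
have sN e : e \in d :: s ++ s' -> 0 <= N%:Z + e.
  by move=> es; rewrite /N (big_rem e) //=; lia.
have [] := @laurent_coef N s c d us c0 _.
  by move=> e; rewrite inE => es; apply: sN; rewrite inE mem_cat orbA es.
have [] := @laurent_coef N s' c' d us' c0' _.
  by move=> e; rewrite inE => es; apply: sN; rewrite inE mem_cat orbCA es orbT.
move=> p ep epd p' ep' epd'.
have epp : p' = p by apply/eqP; rewrite -tofrac_eq -ep -ep' cc'.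
have : (c d)%:R = (c' d)%:R :> rat by rewrite -epd -epd' epp.
by move/eqP; rewrite Num.Theory.eqr_nat => /eqP.
Qed.

Lemma graded_dim_uniq (K : fieldType) (W W' : vectType K) (g : int -> {vspace W})
    (g' : int -> {vspace W'}) s s' : grading g s -> grading g' s' ->
  graded_dim g s = graded_dim g' s' -> forall d, \dim (g d) = \dim (g' d).
Proof.
move=> [us g0 _ _] [us' g0' _ _] e; apply: (laurent_uniq us us' _ _ e) => d.
  by move/g0 ->; rewrite dimv0.
by move/g0' ->; rewrite dimv0.
Qed.

Section Representation.
Variables (K : fieldType) (T : three_strands (edge_cat K)).
Local Notation ev := (@edgev K 3).
Local Notation W := (ts_W T).
Local Notation rho := (ts_rho T).
Local Notation v0 := (ts_v T).

Let rho_lin : linear rho. Proof. by case: (ts_iso T). Qed.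
Let rho_bij : bijective rho. Proof. by case: (ts_iso T). Qed.
Let rhoM (a b : edge_alg K 3) w : rho (a * b) w = rho a (rho b w).
Proof. by case: (ts_iso T) => _ _ _ H _; rewrite H comp_lfunE. Qed.
Lemma ts_rho0 : rho 0 = 0.
Proof. by have := linear_funZ rho_lin 0 0; rewrite !scale0r. Qed.
Let rho_inj : injective rho. Proof. exact: bij_inj. Qed.

Lemma ts_dimE d : \dim (ts_g T d) = \dim (edgeW_comp K 3 d).
Proof.
apply: (graded_dim_uniq (ts_grading T) (edge_grading K 3)).
by rewrite (ts_dim T) edge_graded_dim sum_qvar_wt.
Qed.

Lemma ts_support d : ts_g T d != 0%VS -> -3 <= d <= 3.
Proof.
rewrite -dimv_eq0 ts_dimE dim_edgeW_comp -lt0n => /card_gt0P[w]; rewrite inE => /eqP <-.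
by rewrite wt3; have := le3_coxlen w; lia.
Qed.

(** The degrees that occur lie between -3 and 3, so a shift by 6 can only go from
    the bottom degree to the top one. *)
Lemma ts_shift6 (f : 'End(W)) : end_deg (ts_g T) 6 f -> f != 0 ->
  exists2 x, f x != 0 & f x \in ts_g T 3.
Proof.
move=> f6 f0; have [us g0 sum_g _] := ts_grading T.
have /allPn[d ds /subvPn[x xd]] : ~~ all (fun d => ts_g T d <= lker f)%VS (ts_s T).
  apply: contra f0 => /allP all0; apply/eqP/lfunP => x; rewrite lfunE /=.
  have : (fullv <= lker f)%VS.
    rewrite -sum_g big_seq; elim/big_ind: _ => [|U V|d /all0//].
      by rewrite sub0v.
    by rewrite subv_add => -> ->.
  by move/subvP/(_ x (memvf x)); rewrite memv_ker => /eqP.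
rewrite memv_ker => fx0; have fxd := subvP (f6 d) _ (memv_img f xd).
exists x => //; suff ed : d = -3 by move: fxd; rewrite ed.
have nz y k : y \in ts_g T k -> y != 0 -> ts_g T k != 0%VS.
  by move=> yk; apply: contraNneq => gk; rewrite gk memv0 in yk.
have x0 : x != 0 by apply: contraNneq fx0 => ->; rewrite linear0.
by have := ts_support (nz _ _ xd x0); have := ts_support (nz _ _ fxd fx0); lia.
Qed.

(** The operator [rho(E_(1,w_0))] has degree 6 and is nonzero, so it takes a
    nonzero multiple of [v] as a value; [E_(1,1) E_(1,w_0) = E_(1,w_0)] fixes it. *)
Lemma ts_v_fixed : rho (edge_unit K 1 1) v0 = v0.
Proof.
pose f := rho (edge_unit K 1 w_121).
have f6 : end_deg (ts_g T) 6 f.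
  have [_ _ _ _ H] := ts_iso T; apply/H => /=.
  have := @edge_unit_deg K 3 1 w_121; rewrite !wt3 coxlen_w_121 coxlenE inversions1.
  by [].
have f0 : f != 0.
  rewrite -ts_rho0 (inj_eq rho_inj); apply/eqP => e.
  have := edge_unitE K 1 w_121 w_121; rewrite eqxx e edge_0E.
  by move/esym/eqP; rewrite (negPf (edgev_neq0 K _)).
have [x fx0 fx3] := ts_shift6 f6 f0.
have ff : rho (edge_unit K 1 1) (f x) = f x by rewrite -rhoM edge_unit_mul eqxx.
move: fx3; rewrite ts_v_top => /vlineP[c ec].
have c0 : c != 0 by apply: contraNneq fx0 => e; rewrite ec e scale0r.
by apply: (scalerI c0); rewrite -linearZ -ec.
Qed.

(** The isomorphism of representations from the edge space onto [W_3], built from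
    [rho] and [v], the only link between the two spaces. *)
Definition ts_theta (x : edgeW K 3) : W :=
  rho (edge_of (fun w => if w == 1%g then x else 0)) v0.

(** If [E_(x,1)] sends [v_id] to [x] and kills the other basis vectors, then
    [a E_(x,1) = E_(a x,1)]. *)
Lemma ts_thetaE a x : ts_theta (edge_app a x) = rho a (ts_theta x).
Proof.
rewrite /ts_theta -rhoM; congr (rho _ _); apply: edge_ext => w.
by rewrite edge_mulE !edge_ofE; case: eqP => _; rewrite ?linear0.
Qed.

Lemma ts_theta1 : ts_theta (ev 1%g) = v0.
Proof. exact: ts_v_fixed. Qed.

Lemma ts_theta_linear : linear ts_theta.
Proof.
move=> c x y; rewrite /ts_theta -scale_lfunE -add_lfunE -rho_lin; congr (rho _ _).
apply: edge_ext => w; rewrite edge_linE !edge_ofE.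
by case: eqP => // _; rewrite scaler0 addr0.
Qed.

Lemma ts_theta_eq0 x : ts_theta x = 0 -> x = 0.
Proof.
move=> tx; apply/ffunP => w; rewrite ffunE; apply/eqP; apply: contraT => xw.
have e : edge_app (edge_unit K 1 w) x = x w *: ev 1%g.
  rewrite edge_app_expand (bigD1 w) //= edge_unitE eqxx big1 ?addr0 // => v /negPf nv.
  by rewrite edge_unitE nv scaler0.
have := ts_thetaE (edge_unit K 1 w) x; rewrite tx linear0 e.
rewrite (linear_funZ ts_theta_linear) ts_theta1 => /eqP.
by rewrite scaler_eq0 (negPf xw) (negPf (ts_v_neq0 T)).
Qed.

Lemma ts_theta_surj w : exists a : edge_alg K 3, rho a v0 = w.
Proof.
have [rho' _ rhoK] := rho_bij.
(* [rho] is onto, so it takes as a value some rank-one operator with [v0] |-> [w] *)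
pose F x := coord [tuple v0] ord0 x *: w.
have F_lin : linear F by move=> c x y; rewrite /F linearP scalerDl scalerA.
exists (rho' (linfun F)); rewrite rhoK linfun_linearE // /F.
have := @coord_free _ _ _ [tuple v0] ord0 ord0.
by rewrite /= seq1_free ts_v_neq0 => /(_ isT) ->; rewrite scale1r.
Qed.
End Representation.


(** * The three-strand parameters *)

Lemma braid_scale (K : fieldType) (A : algType K) (c : K) (x y : A) :
  y * x * y = x * y * x ->
  (c *: y) * (c *: x) * (c *: y) = (c *: x) * (c *: y) * (c *: x).
Proof. by move=> e; rewrite -!scalerAl -!scalerAr -!scalerAl e. Qed.

Section StrandScalars.
Variables (K : fieldType) (T : three_strands (edge_cat K)).
Local Notation s1 := (shl 1 (ord0 : 'I_2.-1)).
Local Notation s2 := (shr 1 (ord0 : 'I_2.-1)).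
Local Notation ev := (@edgev K 3).
Local Notation rho := (ts_rho T).
Local Notation theta := (ts_theta T).

(** The degrees on two strands leave only a scalar for each generator, and the
    anticommutation relation makes the two scalars inverse to each other. *)
Lemma ts_scalars : exists t t' : K, [/\ t' * t = 1,
  [/\ ts_d1 T = t *: edge_d K s1 & ts_d2 T = t *: edge_d K s2] &
  [/\ ts_dm1 T = t' *: edge_dm K s1 & ts_dm2 T = t' *: edge_dm K s2]].
Proof.
have [t et] := edge2_deg (ts_d_deg T); have [t' et'] := edge2_degm (ts_dm_deg T).
exists t, t'; rewrite /ts_d1 /ts_d2 /ts_dm1 /ts_dm2 /= et et'.
rewrite !edge_psiZl !edge_psiZr edge_psi_d_l edge_psi_d_r edge_psi_dm_l edge_psi_dm_r; split=> //.
have := ts_ddm T; rewrite et et' => e.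
have : edge_app ((t' * t) *: (1 : edge_alg K 2)) (edgev K 1%g) = edgev K 1%g.
  rewrite -[RHS]edge_1E -(edge_ddm K (ord0 : 'I_2.-1)) scalerDr.
  rewrite edge_ddm -[in RHS]e; congr (edge_app _ _).
  by rewrite -!scalerAl -!scalerAr !scalerA mulrC [t * _]mulrC.
rewrite edge_scaleE edge_1E => /ffunP/(_ 1%g); rewrite ffunE edgevE eqxx.
by rewrite /GRing.scale /= mulr1.
Qed.

(** The tables for the edge space transported by [ts_theta].  Each vector is a
    power of [t] times the image of a basis vector, and each [d^-] removes one
    factor [t]. *)
Lemma ts_table : let act (a : edge_alg K 3) w := rho a w in
  let v := ts_v T in let v1 := act (ts_d1 T) v in let v2 := act (ts_d2 T) v in
  let v12 := act (ts_d1 T * ts_d2 T) v in let v21 := act (ts_d2 T * ts_d1 T) v in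
  let v_ := act (ts_d1 T * ts_d2 T * ts_d1 T) v in
  [/\ [/\ v1 != 0, v2 != 0, v12 != 0, v21 != 0 & v_ != 0],
      [/\ act (ts_dm1 T) v_ = v21, act (ts_dm1 T) v12 = v2 & act (ts_dm1 T) v21 = 0],
      [/\ act (ts_dm1 T) v1 = v, act (ts_dm1 T) v2 = 0 & act (ts_dm1 T) v = 0],
      [/\ act (ts_dm2 T) v_ = v12, act (ts_dm2 T) v12 = 0 & act (ts_dm2 T) v21 = v1] &
      [/\ act (ts_dm2 T) v1 = 0, act (ts_dm2 T) v2 = v & act (ts_dm2 T) v = 0]].
Proof.
move=> act v; have [t [t' [tt [-> ->] [-> ->]]]] := ts_scalars.
have [D1 D2 D12 D21 [D121 D212]] := d_table K.
have [[M1 M2 M3] [M4 M5 M6] [N1 N2 N3] [N4 N5 N6]] := dm_table K.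
have thZ := linear_funZ (ts_theta_linear T).
have t0 : t != 0 by apply: contra_eq_neq tt => ->; rewrite mulr0 eq_sym oner_eq0.
have th0 : theta 0 = 0 by rewrite -(scale0r (0 : edgeW K 3)) thZ scale0r.
have S c a k x y : edge_app a x = y -> act (c *: a) (k *: theta x) = (c * k) *: theta y.
  move=> <-; rewrite -thZ; apply: etrans (esym (ts_thetaE T (c *: a) _)) _.
  by rewrite edge_scaleE [edge_app a _]linearZ !thZ scalerA.
have actM a b w : act (a * b) w = act a (act b w).
  by rewrite /act; case: (ts_iso T) => _ _ _ H _; rewrite H comp_lfunE.
have nz x k w : x = k *: theta (ev w) -> k != 0 -> x != 0.
  move=> -> k0; rewrite scaler_eq0 negb_or k0; apply: contra (edgev_neq0 K w).
  by move/eqP/ts_theta_eq0/eqP.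
have up a x k w w' : x = k *: theta (ev w) -> edge_app a (ev w) = ev w' ->
    act (t *: a) x = (t * k) *: theta (ev w') by move=> ->; apply: S.
have down a x y k w w' : x = (t * k) *: theta (ev w) -> edge_app a (ev w) = ev w' ->
    y = k *: theta (ev w') -> act (t' *: a) x = y.
  by move=> -> e ->; rewrite (S _ _ _ _ _ e) mulrA tt mul1r.
have kill a x k w : x = k *: theta (ev w) -> edge_app a (ev w) = 0 -> act (t' *: a) x = 0.
  by move=> -> e; rewrite (S _ _ _ _ _ e) th0 scaler0.
have vE : v = 1 *: theta (ev 1%g) by rewrite scale1r ts_theta1.
have v1E := up _ _ _ _ _ vE D1; have v2E := up _ _ _ _ _ vE D2.
have v12E := etrans (actM _ _ _) (up _ _ _ _ _ v2E D12).
have v21E := etrans (actM _ _ _) (up _ _ _ _ _ v1E D21).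
have v121E := etrans (actM _ _ _) (etrans (actM _ _ _)
  (up _ _ _ _ _ (up _ _ _ _ _ v1E D21) D121)).
have t1 : t * 1 != 0 by rewrite mulr1.
have t2 : t * (t * 1) != 0 by rewrite mulf_neq0.
split; split.
- exact: nz v1E t1.
- exact: nz v2E t1.
- exact: nz v12E t2.
- exact: nz v21E t2.
- by apply: nz v121E _; rewrite mulf_neq0.
- exact: down v121E M1 v21E.
- exact: down v12E M2 v2E.
- exact: kill v21E M3.
- exact: down v1E M4 vE.
- exact: kill v2E M5.
- exact: kill vE M6.
- exact: down v121E N1 v12E.
- exact: kill v12E N2.
- exact: down v21E N3 v1E.
- exact: kill v1E N4.
- exact: down v2E N5 vE.
exact: kill vE N6.
Qed.

Lemma ts_braid : ts_d2 T * ts_d1 T * ts_d2 T = ts_d1 T * ts_d2 T * ts_d1 T.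
Proof.
have [t [_ [_ [-> ->] _]]] := ts_scalars; have := braid_d K.
exact: braid_scale.
Qed.

Lemma ts_generatedT : ts_generated T.
Proof.
have [t [t' [tt [e1 e2] _]]] := ts_scalars.
move=> w; have [b <-] := ts_theta_surj w.
have [a ga ea] := edge_plus_reach (edge_app b (ev 1%g)).
exists a; last by rewrite -(ts_theta1 T) -!ts_thetaE ea.
move=> B cB sB; apply: (ga B cB) => _ [i ->].
have [_ BL _] := cB; have B0 : 0 \in B.
  by have [B1 _ _] := cB; rewrite -(addNr 1) -scaleN1r; apply: BL.
have inB (x y : edge_alg K 3) : x = t *: y -> x \in B -> y \in B.
  by move=> -> xB; rewrite -[y]addr0 -[y]scale1r -tt -scalerA; apply: BL.
case: i => [[|[|//]] lti].
  rewrite (_ : Ordinal lti = s1); last exact: val_inj.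
  by apply: (inB _ _ e1); apply: sB; left.
rewrite (_ : Ordinal lti = s2); last exact: val_inj.
by apply: (inB _ _ e2); apply: sB; right.
Qed.

(** The vectors that multiply the scalars are nonzero, so the defining equations
    determine the scalars one after the other. *)
Lemma ts_parametersP nu l1 l2 l3 m1 m2 m3 :
  three_strand_parameters T nu l1 l2 l3 m1 m2 m3 <->
  [/\ nu = 1, [/\ l1 = 0, l2 = 0 & l3 = 0] & [/\ m1 = 0, m2 = 0 & m3 = 0]].
Proof.
have gen := ts_generatedT; have braid := ts_braid.
have [[z1 z2 z12 z21 z_] [a_ a12 a21] [a1 a2 a0] [b_ b12 b21] [b1 b2 b0]] := ts_table.
split; last first.
  move=> [-> [-> -> ->] [-> -> ->]]; rewrite /three_strand_parameters.
  rewrite invr1 !mulr0 !oppr0 !scale1r !scale0r !addr0 !subr0.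
  by split=> //; exact: oner_neq0.
have inj0 (k : K) (x y : ts_W T) : x != 0 -> y = y + k *: x -> k = 0.
  move=> x0 /eqP; rewrite -[X in X == _]addr0 (inj_eq (addrI _)) eq_sym.
  by rewrite scaler_eq0 (negPf x0) orbF => /eqP.
have inj1 (k : K) (x : ts_W T) : x != 0 -> 0 = k *: x -> k = 0.
  by move=> x0 e; apply: (inj0 _ x 0) => //; rewrite add0r.
case=> _ _ eb [e1 e2 e3 _] [f1 f2 f3 _].
have nu1 : nu = 1.
  have z : ts_d1 T * ts_d2 T * ts_d1 T != 0.
    by apply: contraNneq z_ => ->; rewrite ts_rho0 lfunE.
  have : (nu - 1) *: (ts_d1 T * ts_d2 T * ts_d1 T) = 0.
    by rewrite scalerBl scale1r -eb braid subrr.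
  by move/eqP; rewrite scaler_eq0 (negPf z) orbF subr_eq0 => /eqP.
have l10 : l1 = 0 := inj0 _ _ _ z12 (etrans (esym a_) e1).
rewrite nu1 invr1 scale1r in f1; rewrite l10 scale0r subr0 in e3.
have m10 : m1 = 0 := inj0 _ _ _ z21 (etrans (esym b_) f1).
rewrite m10 mulr0 scale0r subr0 in f2.
split=> //; split=> //.
- exact: inj0 z1 (etrans (esym a12) e2).
- exact: inj1 z1 (etrans (esym a21) e3).
- exact: inj0 z2 (etrans (esym b21) f3).
exact: inj1 z2 (etrans (esym b12) f2).
Qed.

End StrandScalars.


(** * Divided differences and the comparison with NC *)

Section DividedDifferenceDegree.
Variables (K : fieldType) (n : nat).
Local Notation P := {mpoly K[n]}.
Implicit Types (i : 'I_n.-1) (p q : P).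

Lemma pihomog_mulX d (k : 'I_n) p :
  pihomog mdeg d.+1 ('X_k * p) = 'X_k * pihomog mdeg d p.
Proof.
elim/mpolyind: p => [|c m p _ _ IH]; first by rewrite mulr0 !raddf0 mulr0.
rewrite mulrDr !raddfD /= mulrDr -{}IH; congr (_ + _).
rewrite -scalerAr !linearZ /= -mpolyXD !pihomogX /= mdegD mdeg1 add1n eqSS.
by case: ifP => _; rewrite -?scalerAr ?mpolyXD // mulr0 !scaler0.
Qed.

Lemma pihomog0_mulX (k : 'I_n) p : pihomog mdeg 0 ('X_k * p) = 0.
Proof.
elim/mpolyind: p => [|c m p _ _ IH]; first by rewrite mulr0 raddf0.
rewrite mulrDr !raddfD /= {}IH addr0 -scalerAr linearZ /= -mpolyXD.
by rewrite pihomogX /= mdegD mdeg1 scaler0.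
Qed.

(** Taking the homogeneous component commutes with multiplication by a variable,
    up to a shift, and with [s_i]; so the component of degree [d] of the quotient
    satisfies the equation that characterizes the quotient. *)
Lemma ddiff_homog d i p : p \is d.+1.-homog -> ddiff_fun i p \is d.-homog.
Proof.
rewrite !homog_piE => /eqP pd; apply/eqP/ddiff_uniq.
rewrite mulrBl -!pihomog_mulX -raddfB /= -mulrBl ddiff_funE raddfB /=.
by rewrite -msym_pihomog pd.
Qed.

Lemma ddiff_homog0 i p : p \is 0.-homog -> ddiff_fun i p = 0.
Proof.
rewrite homog_piE => /eqP pd; apply/esym/ddiff_uniq.
have := congr1 (pihomog mdeg 0) (ddiff_funE i p).
by rewrite mulrBl !raddfB /= !pihomog0_mulX -msym_pihomog pd mulr0 subr0.
Qed.

Lemma nc_d_deg i : nc_deg (-2) (nc_d K i).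
Proof.
move=> [|k] p pk; first by left; apply: ddiff_homog0.
by right; exists k; [lia|apply: ddiff_homog].
Qed.

Lemma nc_dm_deg i : nc_deg 2 (nc_dm K i).
Proof.
move=> k p pk; right; exists k.+1; first by lia.
have Xh (l : 'I_n) : ('X_l : P) \is 1.-homog by rewrite dhomogX /= mdeg1.
rewrite -[pe_fun _ _]/(- ('X_(pos_l i) * ddiff_fun i ('X_(pos_r i) * p))).
rewrite dhomogN; apply: (dhomogM (d := 1) (Xh _)); apply: ddiff_homog.
exact: (dhomogM (d := 1) (Xh _)).
Qed.

Lemma ddiff_X i (k : 'I_n) : ddiff_fun i 'X_k =
  (if k == pos_l i then 1 else if k == pos_r i then -1 else 0) :> P.
Proof.
apply/esym/ddiff_uniq; rewrite msym_sreflU /srefl.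
case: tpermP => [->|->|/eqP kl /eqP kr].
- by rewrite eqxx mulr1.
- by rewrite eqxx -val_eqE /= gtn_eqF // mulrN1 opprB.
by rewrite (negPf kl) (negPf kr) mulr0 subrr.
Qed.

(** The operator [d_i^- d_i], which equals [x_i d_i]. *)
Definition nc_proj i : P -> P := fun p => pe_fun (nc_val (nc_dm K i * nc_d K i)) p.

Lemma nc_projX i (k : 'I_n) : nc_proj i 'X_k =
  (if k == pos_l i then 'X_(pos_l i) else if k == pos_r i then - 'X_(pos_l i) else 0) :> P.
Proof.
pose F p : P := - ('X_(pos_l i) * ddiff_fun i ('X_(pos_r i) * p)).
rewrite -[LHS]/(F (ddiff_fun i 'X_k)) ddiff_X.
have F1 : F 1 = 'X_(pos_l i).
  by rewrite /F mulr1 ddiff_X eqxx -val_eqE /= gtn_eqF // mulrN1 opprK.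
case: ifP => // _; case: ifP => _; last by rewrite /F mulr0 linear0 mulr0 oppr0.
by rewrite -F1 /F mulrN linearN /= mulrN.
Qed.

End DividedDifferenceDegree.

Section NotIsomorphic.
Variable K : fieldType.
Local Notation i0 := (ord0 : 'I_2.-1).
Local Notation s1 := (shl 1 i0).
Local Notation s2 := (shr 1 i0).

(** On [x_2] one has [x_1 d_1 x_2 d_2 x_2 = - x_1], while [d_2] kills
    [x_1 d_1 x_2 = - x_1]. *)
Lemma nc_proj_not_comm :
  nc_dm K s1 * nc_d K s1 * (nc_dm K s2 * nc_d K s2) <>
  nc_dm K s2 * nc_d K s2 * (nc_dm K s1 * nc_d K s1).
Proof.
have l2 : @pos_l 3 s2 = @pos_r 3 s1 by apply: val_inj.
have l1 : (@pos_r 3 s1 == @pos_l 3 s1) = false by rewrite -val_eqE.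
have l12 : (@pos_l 3 s1 == @pos_r 3 s1) = false by rewrite -val_eqE.
have r2 : (@pos_l 3 s1 == @pos_r 3 s2) = false by rewrite -val_eqE.
pose x : {mpoly K[3]} := 'X_(@pos_l 3 s1); pose y : {mpoly K[3]} := 'X_(@pos_r 3 s1).
have p2y : nc_proj s2 y = y by rewrite /y (@nc_projX K 3) l2 eqxx.
have p1y : nc_proj s1 y = - x by rewrite /y (@nc_projX K 3) l1 eqxx.
have p2x : nc_proj s2 x = 0 by rewrite /x (@nc_projX K 3) l2 l12 r2.
have projN : nc_proj s2 (- x) = - nc_proj s2 x by rewrite /nc_proj linearN.
move=> comm; have : nc_proj s1 (nc_proj s2 y) = nc_proj s2 (nc_proj s1 y).
  exact: (congr1 (fun a : nc_alg K 3 => pe_fun (nc_val a) y) comm).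
rewrite p2y p1y projN p2x => /eqP.
by rewrite oppr0 oppr_eq0 -msupp_eq0 msuppX.
Qed.

(** [nc_psiE] asks for a generator on each side, and there is none on one strand. *)
Lemma nc_psi_gens :
  [/\ nc_psi (nc_d K i0) (1 : nc_alg K 1) = nc_d K s1,
    nc_psi (nc_dm K i0) (1 : nc_alg K 1) = nc_dm K s1,
    nc_psi (1 : nc_alg K 1) (nc_d K i0) = nc_d K s2 &
    nc_psi (1 : nc_alg K 1) (nc_dm K i0) = nc_dm K s2].
Proof.
split; apply: val_inj => /=.
- exact: tens_ddiff_l.
- exact: tens_ddiffm_l.
- exact: tens_ddiff_r.
- exact: tens_ddiffm_r.
Qed.

(** Rescaling the generators rescales both sides of the commutation by the same
    factor. *)
Lemma rmorph_proj_comm (A B : algType K) (f : {lrmorphism A -> B}) (t t' : K)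
    (d d' m m' : A) (D D' M M' : B) :
  D = f (t *: d) -> D' = f (t *: d') -> M = f (t' *: m) -> M' = f (t' *: m') ->
  m * d * (m' * d') = m' * d' * (m * d) -> M * D * (M' * D') = M' * D' * (M * D).
Proof.
move=> -> -> -> -> comm; rewrite -!rmorphM; congr (f _).
have scaleM (c c' : K) (x y : A) : (c *: x) * (c' *: y) = (c * c') *: (x * y).
  by rewrite -scalerAl -scalerAr scalerA.
by rewrite !scaleM comm.
Qed.

Lemma edge_nc_not_iso : ~ graded_monoidal_iso (edge_cat K) (nc_cat K).
Proof.
move=> [Phi [Phi_bij Phi_deg Phi_psi]].
have [Psi _ PhiK] := Phi_bij 2.
have [P1l P1r P2l P2r] := nc_psi_gens.
have [t et] : exists t : K, Psi (nc_d K i0) = t *: edge_d K i0.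
  by apply: edge2_deg; apply/(Phi_deg 2); rewrite PhiK; apply: nc_d_deg.
have [t' et'] : exists t' : K, Psi (nc_dm K i0) = t' *: edge_dm K i0.
  by apply: edge2_degm; apply/(Phi_deg 2); rewrite PhiK; apply: nc_dm_deg.
have placed_l (x : nc_alg K 2) c (a : edge_alg K 2) (b : edge_alg K 3) :
    Psi x = c *: a -> edge_psi a (1 : edge_alg K 1) = b ->
    nc_psi x (1 : nc_alg K 1) = Phi 3 (c *: b).
  move=> ex <-; apply: etrans (congr1 (Phi 3) (edge_psiZl c a 1)); rewrite -ex.
  by apply: etrans (esym (Phi_psi 2 1 (Psi x) 1)); rewrite /= PhiK rmorph1.
have placed_r (x : nc_alg K 2) c (a : edge_alg K 2) (b : edge_alg K 3) :
    Psi x = c *: a -> edge_psi (1 : edge_alg K 1) a = b ->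
    nc_psi (1 : nc_alg K 1) x = Phi 3 (c *: b).
  move=> ex <-; apply: etrans (congr1 (Phi 3) (edge_psiZr c 1 a)); rewrite -ex.
  by apply: etrans (esym (Phi_psi 1 2 1 (Psi x))); rewrite /= PhiK rmorph1.
have D1 := etrans (esym P1l) (placed_l _ _ _ _ et (edge_psi_d_l _ _ _)).
have M1 := etrans (esym P1r) (placed_l _ _ _ _ et' (edge_psi_dm_l _ _ _)).
have D2 := etrans (esym P2l) (placed_r _ _ _ _ et (edge_psi_d_r _ _ _)).
have M2 := etrans (esym P2r) (placed_r _ _ _ _ et' (edge_psi_dm_r _ _ _)).
exact: nc_proj_not_comm (rmorph_proj_comm D1 D2 M1 M2 (edge_dmd_comm K _ _)).
Qed.

End NotIsomorphic.

Theorem proposition3p6 (K : fieldType) :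
  [/\ graded_minimal_categorification (edge_cat K),
      forall n : nat,
        [/\ forall x : edgeW K n, exists2 a : edge_alg K n,
              edge_plus a & edge_app a (edgev K 1%g) = x,
            forall x : edgeW K n, exists2 a : edge_alg K n,
              edge_minus a & edge_app a (edgev K (longest n)) = x &
            forall a : edge_alg K n,
              gen_subalg (fun y => (exists i, y = edge_d K i) \/
                                   (exists i, y = edge_dm K i)) a],
      exists T : three_strands (edge_cat K),
        ts_d T = edge_d K (n := 2) ord0 /\ ts_dm T = edge_dm K (n := 2) ord0,
      forall (T : three_strands (edge_cat K)) (nu l1 l2 l3 m1 m2 m3 : K),
        three_strand_parameters T nu l1 l2 l3 m1 m2 m3 <->
        [/\ nu = 1, [/\ l1 = 0, l2 = 0 & l3 = 0] & [/\ m1 = 0, m2 = 0 & m3 = 0]] &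
      ~ graded_monoidal_iso (edge_cat K) (nc_cat K)].
Proof.
split.
- exact: edge_cat_gmc.
- move=> n; split; [exact: edge_plus_reach|exact: edge_minus_reach|].
  by apply: gen_subalg_all => i; [left|right]; exists i.
- by exists (edge_three_strands K).
- exact: ts_parametersP.
exact: edge_nc_not_iso.
Qed.
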